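(* Let $\omega(n)=\sqrt{n\tanh(n)}$ (the dispersion relation of the gravity water wave equation) and let $g$ be a non-constant step function on $\mathbb T=\mathbb R/(2\pi\mathbb Z)$. Then $D_t(\omega,g)\in\left[\frac54,\frac74\right]$ for all $t\ne0$.
   Context: $e^{itL_\omega}g(x)=\sum_{n\in\mathbb Z}\widehat g(n)e^{it\omega(n)+inx}$, and $D_t(\omega,g)$ is the maximum of the fractal dimensions of the graphs of the real and imaginary parts of $e^{itL_\omega}g$ as functions of $x$ (continuous representatives). A step function is a finite linear combination of indicator functions of intervals (arcs). The fractal (upper box-counting) dimension of a bounded set $E$ is $\limsup_{\epsilon\to0}\frac{\log\mathcal N(E,\epsilon)}{\log(1/\epsilon)}$, with $\mathcal N(E,\epsilon)$ the minimum number of $\epsilon$-balls needed to cover $E$. *)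

(* Defs.v *)
From HB Require Import structures.
From mathcomp Require Export all_boot all_order all_algebra.
From mathcomp Require Export all_classical all_reals all_analysis.
From mathcomp Require Export complex.

Set Implicit Arguments.
Unset Strict Implicit.
Unset Printing Implicit Defensive.

Import Order.TTheory GRing.Theory Num.Theory.
Import numFieldNormedType.Exports.

Local Open Scope classical_set_scope.
Local Open Scope ring_scope.
Local Open Scope complex_scope.

(* Functions on the torus R / (2 pi Z) are (2 pi)-periodic functions on R;
   this is the fundamental domain used for integration and for graphs. *)
Definition period_cell (R : realType) : set R := [set` `[0, 2 * pi[].

(* The endpoints of the intervals are unconstrained (and any of them may be
   open, closed or infinite) because only the trace on one period matters; an
   arc through 0 is a sum of two such traces. *)
Definition step_function (R : realType) (g : R -> R[i]) : Prop :=
  periodic g (2 * pi) /\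
  exists (m : nat) (c : 'I_m -> R[i]) (I : 'I_m -> interval R),
    forall x, period_cell x -> g x = \sum_(k < m) c k * \1_[set` I k] x.

(* Non-constancy is that of the class of g modulo null sets. Since degenerate
   intervals are allowed, g may differ from a constant at finitely many points
   only, and then its Fourier series is that of the constant. *)
Definition non_constant (R : realType) (g : R -> R[i]) : Prop :=
  ~ exists c : R[i],
      {ae (@lebesgue_measure R), forall x, period_cell x -> g x = c}.

Definition expi (R : realType) (a : R) : R[i] := cos a +i* sin a.

Definition Cintegral (R : realType) (A : set R) (f : R -> R[i]) : R[i] :=
  Rintegral (@lebesgue_measure R) A (fun x => complex.Re (f x)) +i*
  Rintegral (@lebesgue_measure R) A (fun x => complex.Im (f x)).

Definition fourier_coef (R : realType) (g : R -> R[i]) (n : int) : R[i] :=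
  ((2 * pi)^-1)%:C *
  Cintegral (period_cell (R := R)) (fun x => g x * expi (- (n%:~R * x))).

(* The symmetric partial sum over |n| <= N; the index k stands for n = k - N. *)
Definition evolution_psum (R : realType) (omega : int -> R) (g : R -> R[i])
    (t : R) (N : nat) (x : R) : R[i] :=
  \sum_(k < (2 * N).+1)
    let n : int := k%:Z - N%:Z in
    fourier_coef g n * expi (t * omega n + n%:~R * x).

(* u is a continuous representative of e^{i t L_omega} g, the sum of the
   series being taken in L^2 of the torus. *)
Definition continuous_representative (R : realType) (omega : int -> R)
    (g : R -> R[i]) (t : R) (u : R -> R[i]) : Prop :=
  [/\ periodic u (2 * pi),
      continuous (fun x => complex.Re (u x)),
      continuous (fun x => complex.Im (u x)) &
      (\int[@lebesgue_measure R]_(x in period_cell (R := R))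
         (Normc.normc (evolution_psum omega g t N x - u x) ^+ 2)%:E)%E
        @[N --> \oo] --> 0%E].

Definition plane_ball (R : realType) (c : R * R) (e : R) : set (R * R) :=
  [set p | Num.sqrt ((p.1 - c.1) ^+ 2 + (p.2 - c.2) ^+ 2) < e].

(* The least number of e-balls covering E, and +oo if no finite cover exists. *)
Definition covering_number (R : realType) (E : set (R * R)) (e : R) : \bar R :=
  ereal_inf [set n%:R%:E | n in [set n : nat |
    exists c : 'I_n -> R * R,
      E `<=` [set p | exists k, plane_ball (c k) e p]]].

Definition fractal_dimension (R : realType) (E : set (R * R)) : \bar R :=
  limf_esup (fun e : R => (lne (covering_number E e) * ((ln e^-1)^-1)%:E)%E)
    (0 : R)^'+.

Definition graph_on_torus (R : realType) (f : R -> R) : set (R * R) :=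
  [set p | period_cell p.1 /\ p.2 = f p.1].

(* D_t(omega, g). The continuous representative is unique when it exists; if
   there is none, the default value (the zero function) is meaningless. *)
Definition evolution_dimension (R : realType) (omega : int -> R)
    (g : R -> R[i]) (t : R) : \bar R :=
  let u := xget (fun=> 0) [set u | continuous_representative omega g t u] in
  maxe (fractal_dimension (graph_on_torus (fun x => complex.Re (u x))))
       (fractal_dimension (graph_on_torus (fun x => complex.Im (u x)))).

Definition tanh (R : realType) (x : R) : R :=
  (expR x - expR (- x)) / (expR x + expR (- x)).

Definition gravity_dispersion (R : realType) (n : int) : R :=
  Num.sqrt (n%:~R * tanh n%:~R).

(* Main.v *)
Require Import Defs.
From mathcomp Require Import ring lra zify measurable_realfun.
Set Implicit Arguments.
Unset Strict Implicit.
Unset Printing Implicit Defensive.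

Import Order.TTheory GRing.Theory Num.Theory.
Import numFieldNormedType.Exports.

Local Open Scope classical_set_scope.
Local Open Scope ring_scope.
Local Open Scope complex_scope.

(** With [u] the evolved function, [u = c + sum_j b_j (H (x - x_j) - H (x_j - x))]
    where [H y = sum_(n >= 1) e^(i (t omega(n) + n y)) / n] and the [x_j] are the
    jump points of [g]. Since [omega(n) - sqrt n] is small and
    [sqrt] has second differences of order [n^(-3/2)], van der Corput's test
    gives [sum_(n <= N) e^(i (t omega(n) + n y)) = O(N^(3/4))] uniformly in [y],
    and summation by parts makes [u] Hoelder continuous with exponent 1/4. This
    yields the representative and the upper bound 2 - 1/4 = 7/4.

    For the lower bound, the evolution is unitary, so the L^2 norm squared of
    [u (x + h) - u x] is that of [g (x + h) - g x], hence at least a multiple of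
    [h] because [g] jumps. If the graphs of both parts of [u] were covered by
    [h^(-s)] balls of radius [h], the L^1 norm of the increments would be
    [O(h^(2 - s))]; with the sup bound [O(h^(1/4))] their L^2 norm squared would
    be [O(h^(9/4 - s))], which forces [s >= 5/4]. The L^2 norms are replaced by
    sums over equally spaced points, where Parseval's identity is a finite
    computation. *)

(** The exponent 3/4 is a balance: against second differences of order N^(-3/2), cutting the phase
    increments at size N^(-3/4) makes the two error terms of van der Corput's test equal in order.
    Fractional powers are avoided by writing N^(1/4) as [root4 N] and a length as [q ^+ 4]. In the
    lower bound a ball count only controls first powers of increments, because an oscillation of
    size y over a column of width h costs about y/(2h) balls, whereas jumps of [g] are only visible
    in squares; the sup bound bridges the two. The energy belongs to the real and imaginary parts
    together, so a contradiction arises only when both graphs have small coverings: hence the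
    maximum in D_t. The sampling grid serves two purposes: more than 2N points make Parseval exact
    for a trigonometric polynomial of degree N, and a multiple of M points puts equally many in each
    column of width h = 2 pi / M. This leads to M (2N + 1) points. The energy bound is uniform in N
    for fixed M, so N can tend to infinity to remove the truncation error. *)

Local Notation nc := (@Normc.normc _).

(** * Complex moduli and the unit circle *)

Section ComplexModulus.
Context {R : realType}.
Implicit Types (x y z : R[i]) (a b : R).

Lemma ncE x : nc x = Num.sqrt (complex.Re x ^+ 2 + complex.Im x ^+ 2).
Proof. by case: x. Qed.

Lemma ncD x y : nc (x + y) <= nc x + nc y.
Proof. exact: le_normcD. Qed.

Lemma ncM x y : nc (x * y) = nc x * nc y.
Proof. exact: Normc.normcM. Qed.

Lemma ncN x : nc (- x) = nc x.
Proof. exact: normcN. Qed.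

Lemma ncB x y : nc (x - y) <= nc x + nc y.
Proof. by rewrite -(ncN y); exact: ncD. Qed.

Lemma ncV x : nc x^-1 = (nc x)^-1.
Proof. exact: Normc.normcV. Qed.

Lemma nc_ge0 x : 0 <= nc x.
Proof. by rewrite ncE sqrtr_ge0. Qed.

Lemma nc0 : nc (0 : R[i]) = 0.
Proof. exact: Normc.normc0. Qed.

Lemma nc_eq0 x : (nc x == 0) = (x == 0).
Proof.
by apply/eqP/eqP => [/Normc.eq0_normc//|->]; rewrite nc0.
Qed.

Lemma nc_real a : nc a%:C = `|a|.
Proof. by rewrite ncE/= expr0n/= addr0 sqrtr_sqr. Qed.

Lemma nc_nat n : nc (n%:R : R[i]) = n%:R.
Proof.
have -> : (n%:R : R[i]) = (n%:R : R)%:C by rewrite rmorph_nat.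
by rewrite nc_real normr_nat.
Qed.

Lemma sqr_nc x : nc x ^+ 2 = complex.Re x ^+ 2 + complex.Im x ^+ 2.
Proof. by rewrite ncE sqr_sqrtr// addr_ge0// sqr_ge0. Qed.

Lemma sqr_ncC x : (nc x ^+ 2)%:C = x * conjc x.
Proof.
case: x => a b; rewrite sqr_nc/= /GRing.mul/=.
by congr (_ +i* _); ring.
Qed.

Lemma conjcM x y : conjc (x * y) = conjc x * conjc y.
Proof. exact: rmorphM. Qed.

Lemma conjc_sum I (r : seq I) (P : pred I) (F : I -> R[i]) :
  conjc (\sum_(i <- r | P i) F i) = \sum_(i <- r | P i) conjc (F i).
Proof. exact: raddf_sum. Qed.

Lemma nc_conj x : nc (conjc x) = nc x.
Proof. by case: x => a b; rewrite !ncE/= sqrrN. Qed.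

Lemma normr_Re_le x : `|complex.Re x| <= nc x.
Proof.
by rewrite -sqrtr_sqr ncE ler_wsqrtr// lerDl sqr_ge0.
Qed.

Lemma normr_Im_le x : `|complex.Im x| <= nc x.
Proof.
by rewrite -sqrtr_sqr ncE ler_wsqrtr// lerDr sqr_ge0.
Qed.

Lemma nc_le_ReIm x : nc x <= `|complex.Re x| + `|complex.Im x|.
Proof.
rewrite -(@ler_pXn2r _ 2)// ?nnegrE ?nc_ge0 ?addr_ge0//.
rewrite sqr_nc sqrrD !real_normK ?num_real//.
have : 0 <= `|complex.Re x| * `|complex.Im x| by rewrite mulr_ge0.
by set p := _ * _; lra.
Qed.

Lemma ReB x y : complex.Re (x - y) = complex.Re x - complex.Re y.
Proof. by case: x y => ? ? []. Qed.

Lemma ImB x y : complex.Im (x - y) = complex.Im x - complex.Im y.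
Proof. by case: x y => ? ? []. Qed.

Lemma nc_sum I (r : seq I) (P : pred I) (F : I -> R[i]) :
  nc (\sum_(i <- r | P i) F i) <= \sum_(i <- r | P i) nc (F i).
Proof.
elim/big_rec2 : _ => [|i a z _ h]; first by rewrite nc0.
by rewrite (le_trans (ncD _ _))// lerD2l.
Qed.

Lemma sqr_ncD_le x y : nc (x + y) ^+ 2 <= 2 * nc x ^+ 2 + 2 * nc y ^+ 2.
Proof.
have h := ncD x y.
have : nc (x + y) ^+ 2 <= (nc x + nc y) ^+ 2.
  by rewrite ler_pXn2r// nnegrE ?nc_ge0// addr_ge0// nc_ge0.
by have := sqr_ge0 (nc x - nc y); nra.
Qed.

End ComplexModulus.

Section UnitCircle.
Context {R : realType}.
Implicit Types a b x y : R.

Lemma expiD a b : expi (a + b) = expi a * expi b.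
Proof.
rewrite /expi cosD sinD /GRing.mul/= /GRing.mul/=; congr (_ +i* _); ring.
Qed.

Lemma expi0 : expi (0 : R) = 1.
Proof. by rewrite /expi cos0 sin0. Qed.

Lemma conj_expi a : conjc (expi a) = expi (- a).
Proof. by rewrite /expi/= cosN sinN. Qed.

Lemma nc_expi a : nc (expi a) = 1.
Proof. by rewrite ncE/= cos2Dsin2 sqrtr1. Qed.

Lemma expi_neq0 a : expi a != 0.
Proof. by rewrite -nc_eq0 nc_expi oner_eq0. Qed.

Lemma expiN a : expi (- a) = (expi a)^-1.
Proof.
by apply: (mulIf (expi_neq0 a)); rewrite mulVf ?expi_neq0// -expiD addNr expi0.
Qed.

Lemma expiB a b : expi (a - b) = expi a / expi b.
Proof. by rewrite expiD expiN. Qed.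

Lemma expiMn a n : expi (a *+ n) = expi a ^+ n.
Proof.
elim: n => [|n IH]; first by rewrite mulr0n expi0.
by rewrite mulrS expiD IH exprS.
Qed.

Lemma expi_2pi : expi (2 * pi) = 1 :> R[i].
Proof. by rewrite /expi mulr_natl cos2pi sin2pi. Qed.

Lemma expi_period_nat a n : expi (a + n%:R * (2 * pi)) = expi a.
Proof. by rewrite expiD mulr_natl expiMn expi_2pi expr1n mulr1. Qed.

Lemma expi_period_int a (n : int) : expi (a + n%:~R * (2 * pi)) = expi a.
Proof.
case: n => n; first exact: expi_period_nat.
rewrite NegzE mulrNz mulNr expiB; have := expi_period_nat 0 n.+1.
by rewrite add0r expi0 => ->; rewrite divr1.
Qed.

Lemma nc_expiB1 a : nc (expi a - 1) = 2 * `|sin (a / 2)|.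
Proof.
have -> : nc (expi a - 1) = Num.sqrt ((2 * sin (a / 2)) ^+ 2).
  rewrite ncE; congr Num.sqrt.
  have {1 2}-> : a = (a / 2) *+ 2 by rewrite mulr2n; lra.
  rewrite ReB ImB/= cos_mulr2n sin_mulr2n subr0.
  have := cos2Dsin2 (a / 2); set c := cos _; set s := sin _ => h.
  have cE : c ^+ 2 = 1 - s ^+ 2 by lra.
  have -> : (c * s *+ 2) ^+ 2 = 4 * (c ^+ 2) * s ^+ 2 by ring.
  by rewrite cE; ring.
by rewrite sqrtr_sqr normrM ger0_norm.
Qed.

Lemma sin_MVT x : 0 <= x -> exists2 c, 0 <= c <= x & sin x = cos c * x.
Proof.
move=> x0; have [c cx h] : exists2 c : R, c \in `[0, x] & sin x - sin 0 = cos c * (x - 0).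
  apply: (@MVT_segment _ _ cos) => //.
  by apply: continuous_subspaceT => z; exact: continuous_sin.
by exists c; [rewrite in_itv/= in cx|move: h; rewrite sin0 !subr0].
Qed.

Lemma normr_sin_le x : `|sin x| <= `|x|.
Proof.
wlog x0 : x / 0 <= x.
  move=> H; have [/H//|/ltW x0] := leP 0 x.
  by rewrite -[X in X <= _]normrN -sinN -[X in _ <= X]normrN H// oppr_ge0.
have [c _ ->] := sin_MVT x0.
by rewrite normrM ler_piMl// cos_max.
Qed.

Lemma cos_lb x : 1 - x ^+ 2 / 2 <= cos x.
Proof.
have {2}-> : x = (x / 2) *+ 2 by rewrite mulr2n; lra.
have h := normr_sin_le (x / 2).
rewrite cos_mulr2n cos2sin2.
have : sin (x / 2) ^+ 2 <= (x / 2) ^+ 2.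
  by rewrite -[leLHS]real_normK ?num_real// -[leRHS]real_normK ?num_real// ler_pXn2r.
lra.
Qed.

(** On [0, 1] the mean value theorem gives sin x >= x / 2. Beyond 1 the point is within distance 1
    of pi / 2, so sin x >= 1/2, while x <= 5/2 because pi < 4: this is the origin of the constant
    5. *)
Lemma sin_lb x : 0 <= x <= (pi + 1) / 2 -> x / 5 <= sin x.
Proof.
move=> /andP[x0 xp].
have p2 := @pihalf_lt2 R; have p1 := @pihalf_ge1 R.
have [x1|x1] := leP x 1.
  have [c /andP[c0 cx] ->] := sin_MVT x0.
  have := cos_lb c; nra.
rewrite -cosBpihalf.
have := cos_lb (x - pi / 2).
nra.
Qed.

Lemma nc_expiB1_ub a : nc (expi a - 1) <= `|a|.
Proof.
rewrite nc_expiB1; have := normr_sin_le (a / 2).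
by rewrite normrM (ger0_norm (x := 2^-1))//; lra.
Qed.

(** The range pi + 1 leaves room for a phase reduced modulo 2 pi, of size at most pi, plus a drift
    of size at most 1 coming from the dispersion. *)
Lemma nc_expiB1_lb a : `|a| <= pi + 1 -> `|a| / 5 <= nc (expi a - 1).
Proof.
move=> ha; rewrite nc_expiB1.
wlog a0 : a ha / 0 <= a.
  move=> H; have [/H|/ltW a0] := leP 0 a; first exact.
  have := H (- a); rewrite normrN oppr_ge0 mulNr sinN normrN; exact.
rewrite ger0_norm// in ha *.
have : (a / 2) / 5 <= sin (a / 2) by apply: sin_lb; lra.
by have := ler_norm (sin (a / 2)); lra.
Qed.

Lemma nc_expiB a b : nc (expi a - expi b) = nc (expi (a - b) - 1).
Proof.
have -> : expi a - expi b = expi b * (expi (a - b) - 1).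
  by rewrite mulrBr mulr1 -expiD (addrC b) subrK.
by rewrite ncM nc_expi mul1r.
Qed.

Lemma nc_expiB_le a b : nc (expi a - expi b) <= `|a - b|.
Proof. by rewrite nc_expiB nc_expiB1_ub. Qed.

End UnitCircle.

(** * Van der Corput's second derivative test *)

Section SecondDerivativeTest.
Context {R : realType}.
Implicit Types (phi : nat -> R) (z c : nat -> R[i]).

Lemma abel_sum z c n :
  \sum_(0 <= k < n.+1) (z k.+1 - z k) * c k =
  z n.+1 * c n - z 0%N * c 0%N - \sum_(0 <= k < n) z k.+1 * (c k.+1 - c k).
Proof.
elim: n => [|n IH]; first by rewrite big_nat1 big_geq// subr0 mulrBl.
by rewrite big_nat_recr//= IH [in RHS]big_nat_recr//=; ring.
Qed.

Lemma nc_sum_nat m n (F : nat -> R[i]) (G : nat -> R) :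
  (forall k, (m <= k < n)%N -> nc (F k) <= G k) ->
  nc (\sum_(m <= k < n) F k) <= \sum_(m <= k < n) G k.
Proof. by move=> h; rewrite (le_trans (nc_sum _ _ _))// ler_sum_nat. Qed.

Lemma invrB_div (F : fieldType) (a b : F) : a != 0 -> b != 0 ->
  a^-1 - b^-1 = (b - a) / a / b.
Proof. by move=> a0 b0; field; rewrite a0 b0. Qed.

(* With [c_k = 1 / (expi (theta_k) - 1)] one has
   [expi (phi_k) = (expi (phi_(k+1)) - expi (phi_k)) * c_k], and the total
   variation of [c] is controlled by that of [1 / theta], which telescopes. *)
Lemma kusmin_landau phi (theta : nat -> R) n (D : R) :
  (forall k, phi k.+1 = phi k + theta k) ->
  0 <= D ->
  (forall k, (k < n)%N -> theta k != 0) ->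
  (forall k, (k < n)%N -> `|theta k| <= pi + 1) ->
  (forall k, (k < n)%N -> `|theta k|^-1 <= D) ->
  (forall k, (k.+1 < n)%N -> (theta k)^-1 <= (theta k.+1)^-1) ->
  nc (\sum_(0 <= k < n) expi (phi k)) <= 60 * D.
Proof.
move=> phiS D0 t0 tpi tD tm.
case: n => [|n] in t0 tpi tD tm *; first by rewrite big_geq// nc0 mulr_ge0.
pose w k : R[i] := expi (theta k) - 1.
have wlb k : (k < n.+1)%N -> `|theta k| / 5 <= nc (w k).
  by move=> kn; exact/nc_expiB1_lb/tpi.
have w0 k : (k < n.+1)%N -> 0 < nc (w k).
  by move=> kn; rewrite (lt_le_trans _ (wlb _ kn))// divr_gt0// normr_gt0 t0.
have wn0 k : (k < n.+1)%N -> w k != 0.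
  by move=> kn; rewrite -nc_eq0 gt_eqF// w0.
have cD k : (k < n.+1)%N -> nc (w k)^-1 <= 5 * `|theta k|^-1.
  move=> kn; rewrite ncV -[leRHS]invrK invfM !invrK mulrC lef_pV2 ?posrE ?w0//.
  - exact: wlb.
  - by rewrite divr_gt0// normr_gt0 t0.
pose z k : R[i] := expi (phi k).
rewrite (eq_big_nat _ _ (F2 := fun k => (z k.+1 - z k) * (w k)^-1)); last first.
  move=> k /andP[_ kn]; apply: (mulIf (wn0 _ kn)).
  rewrite mulfVK ?wn0// /w mulrBr mulr1 /z -expiD; congr (expi _ - _).
  by rewrite phiS addrC.
rewrite abel_sum.
(* Each 1 / w costs a factor 5 over 1 / theta, and the difference of the w is at most that of the
   theta. By monotonicity of 1 / theta the result is a difference without absolute value, which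
   telescopes. *)
have hv k : (0 <= k < n)%N -> nc (z k.+1 * ((w k.+1)^-1 - (w k)^-1)) <=
    25 * ((theta k.+1)^-1 - (theta k)^-1).
  move=> /andP[_ kn]; have k1 : (k.+1 < n.+1)%N by [].
  have k2 : (k < n.+1)%N by exact: ltnW.
  rewrite ncM nc_expi mul1r.
  have -> : (w k.+1)^-1 - (w k)^-1 = (w k - w k.+1) * (w k.+1)^-1 * (w k)^-1.
    by rewrite -invrB_div ?wn0.
  rewrite 2!ncM.
  have -> : w k - w k.+1 = expi (theta k) - expi (theta k.+1) by rewrite /w; ring.
  have -> : (theta k.+1)^-1 - (theta k)^-1 =
      `|theta k - theta k.+1| * `|theta k.+1|^-1 * `|theta k|^-1.
    rewrite -[LHS]ger0_norm ?subr_ge0 ?tm// -!normfV -!normrM; congr `| _ |.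
    by rewrite -invrB_div ?t0.
  have h1 := nc_expiB_le (theta k) (theta k.+1).
  have h2 := cD _ k1; have h3 := cD _ k2.
  have -> : 25 * (`|theta k - theta k.+1| / `|theta k.+1| / `|theta k|) =
     `|theta k - theta k.+1| * (5 * `|theta k.+1|^-1) * (5 * `|theta k|^-1) by ring.
  by rewrite !ler_pM ?mulr_ge0 ?nc_ge0.
have hs := nc_sum_nat hv.
have tn : \sum_(0 <= i < n) 25 * ((theta i.+1)^-1 - (theta i)^-1) =
          25 * ((theta n)^-1 - (theta 0%N)^-1).
  by rewrite -mulr_sumr telescope_sumr.
rewrite tn in hs.
have a0 : `|(theta 0%N)^-1| <= D by rewrite normfV tD.
have an : `|(theta n)^-1| <= D by rewrite normfV tD.
have c0 := cD 0%N isT; have cn := cD n (ltnSn n).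
have d0 := tD 0%N isT; have dn := tD n (ltnSn n).
move: a0 an; rewrite !ler_norml => /andP[a1 a2] /andP[a3 a4].
(* The two boundary terms give 5 D each and the telescoped variation 25 * 2 D, in total 60 D. *)
apply: (le_trans (ncB _ _)).
have := ncB (z n.+1 * (w n)^-1) (z 0%N * (w 0%N)^-1).
by rewrite !ncM !nc_expi !mul1r; lra.
Qed.

Lemma decreasing_threshold (theta : nat -> R) n (d : R) :
  (forall k, (k.+1 < n)%N -> theta k.+1 <= theta k) ->
  exists p, [/\ (p <= n)%N, forall k, (k < p)%N -> d <= theta k &
    forall k, (p <= k < n)%N -> theta k < d].
Proof.
elim: n => [|n IH] h.
  by exists 0%N; split => // k; rewrite ltn0 andbF.
have [k kn|p [pn p1 p2]] := IH; first by rewrite h// ltnW.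
have [nd|nd] := leP d (theta n); last first.
  exists p; split => //; first exact: leqW.
  move=> k /andP[pk]; rewrite ltnS leq_eqVlt => /orP[/eqP-> //|kn].
  by rewrite p2// pk.
move: pn; rewrite leq_eqVlt => /orP[/eqP pn|pn].
  exists n.+1; split => //; last by move=> k /andP[a b]; lia.
  move=> k; rewrite ltnS leq_eqVlt => /orP[/eqP->//|kn].
  by rewrite p1// pn.
case: n => // n in pn h p2 nd IH *.
have := h n (ltnSn _); have := p2 n; rewrite -ltnS pn ltnSn => /(_ isT).
by move=> a b; have := lt_le_trans (le_lt_trans b a) nd; rewrite ltxx.
Qed.

(* Away from the [theta] of size at most [delta] the Kusmin-Landau bound
   applies; since [theta] decreases by steps at least [lam], few remain. *)
Lemma van_der_corput phi (theta : nat -> R) n (delta lam : R) :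
  (forall k, phi k.+1 = phi k + theta k) ->
  0 < delta -> 0 < lam ->
  (forall k, (k < n)%N -> `|theta k| <= pi + 1) ->
  (forall k, (k.+1 < n)%N -> theta k.+1 + lam <= theta k) ->
  nc (\sum_(0 <= k < n) expi (phi k)) <= 120 / delta + 2 * delta / lam + 1.
Proof.
move=> phiS d0 l0 tpi tm.
have tm' k : (k.+1 < n)%N -> theta k.+1 <= theta k.
  by move=> /tm; lra.
have [p [pn p1 p2]] := decreasing_threshold delta tm'.
have [q [qn q1 q2]] := decreasing_threshold (- delta) tm'.
have pq : (p <= q)%N.
  rewrite leqNgt; apply/negP => qp.
  have := p1 _ qp; have := q2 q; rewrite leqnn (leq_trans qp pn) => /(_ isT).
  lra.
rewrite (big_cat_nat (n := q))//= (big_cat_nat (n := p) (p := q))//=.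
have tdec i j : (i + j < n)%N -> theta (i + j)%N + j%:R * lam <= theta i.
  elim: j => [|j IH] h; first by rewrite addn0 mul0r addr0.
  have := IH; rewrite addnS in h * => /(_ (ltnW h)).
  by have := tm _ h; rewrite -natr1; lra.
have tmono i j : (i <= j)%N -> (j < n)%N -> theta j <= theta i.
  move=> /subnKC <- h; apply: le_trans (tdec _ _ h).
  by rewrite lerDl mulr_ge0// ltW.
have b1 : nc (\sum_(0 <= i < p) expi (phi i)) <= 60 * delta^-1.
  have pos k : (k < p)%N -> 0 < theta k by move=> /p1; exact: lt_le_trans.
  apply: (kusmin_landau phiS) => [|k kp|k kp|k kp|k kp].
  - by rewrite invr_ge0 ltW.
  - by rewrite gt_eqF// pos.
  - by rewrite tpi// (leq_trans kp).
  - by rewrite gtr0_norm ?pos// lef_pV2 ?posrE ?pos// p1.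
  - by rewrite lef_pV2 ?posrE ?pos ?tm' ?(ltnW kp)// (leq_trans kp).
(* Inverses of negative decreasing numbers increase as well, so the same test applies on this side
   of zero. *)
have b3 : nc (\sum_(q <= i < n) expi (phi i)) <= 60 * delta^-1.
  rewrite -{1}[q]add0n big_addn.
  pose phi' k := phi (k + q)%N.
  have neg k : (k < n - q)%N -> theta (k + q)%N < - delta.
    by move=> kp; apply: q2; lia.
  apply: (@kusmin_landau phi' (fun k => theta (k + q)%N)) => [k||k kp|k kp|k kp|k kp].
  - by rewrite /phi' addSn phiS.
  - by rewrite invr_ge0 ltW.
  - by rewrite lt_eqF//; have := neg _ kp; lra.
  - by apply: (tpi (k + q)%N); lia.
  - have h := neg _ kp.
    rewrite ltr0_norm; last lra.
    by rewrite lef_pV2 ?posrE//; lra.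
  - have h1 := neg _ kp; have h2 := neg k (ltnW kp).
    have h3 := tm' (k + q)%N; rewrite addSn in h1 *.
    rewrite lef_nV2 ?negrE; [apply: h3; lia|lra|lra].
(* Here the terms are merely counted: [q - p - 1] descents of at least [lam] fit into the window
   [-delta, delta[. *)
have b2 : nc (\sum_(p <= i < q) expi (phi i)) <= 2 * delta / lam + 1.
  apply: (@le_trans _ _ (\sum_(p <= i < q) 1)).
    by apply: nc_sum_nat => k _; rewrite nc_expi.
  rewrite sumr_const_nat.
  have [->|pq'] := eqVneq q p.
    by rewrite subnn mulr0n addr_ge0// divr_ge0 ?mulr_ge0// ltW.
  have {}pq' : (p < q)%N by rewrite ltn_neqAle eq_sym pq'.
  have := tdec p (q.-1 - p)%N; have -> : (p + (q.-1 - p) = q.-1)%N by lia.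
  have qn' : (q.-1 < n)%N by lia.
  move=> /(_ qn') h.
  have h1 : - delta <= theta q.-1 by apply: q1; lia.
  have h2 : theta p < delta by apply: p2; rewrite leqnn; lia.
  have -> : (q - p = (q.-1 - p).+1)%N by lia.
  rewrite mulrS addrC lerD2r ler_pdivlMr//; lra.
apply: (le_trans (ncD _ _)).
have := ncD (\sum_(0 <= i < p) expi (phi i)) (\sum_(p <= i < q) expi (phi i)).
lra.
Qed.

End SecondDerivativeTest.

(** * Dispersive exponential sums *)

Section FourthRoot.
Context {R : realType}.

Definition root4 (n : nat) : R := Num.sqrt (Num.sqrt n%:R).

Lemma root4_ge0 n : 0 <= root4 n.
Proof. exact: sqrtr_ge0. Qed.

Lemma root4X2 n : root4 n ^+ 2 = Num.sqrt n%:R.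
Proof. by rewrite sqr_sqrtr// sqrtr_ge0. Qed.

Lemma root4X4 n : root4 n ^+ 4 = n%:R.
Proof. by rewrite (exprM _ 2 2) root4X2 sqr_sqrtr. Qed.

Lemma root4_le m n : (m <= n)%N -> root4 m <= root4 n.
Proof. by move=> mn; rewrite !ler_wsqrtr// ler_nat. Qed.

Lemma root40 : root4 0 = 0.
Proof. by rewrite /root4 !sqrtr0. Qed.

Lemma root4_ge1 n : 1 <= root4 n.+1.
Proof. by rewrite -[1](_ : root4 1 = 1) ?root4_le// /root4 !sqrtr1. Qed.

Lemma root4_gt0 n : 0 < root4 n.+1.
Proof. exact: lt_le_trans (root4_ge1 n). Qed.

Lemma root4V_le m n : (m <= n)%N -> (root4 n.+1)^-1 <= (root4 m.+1)^-1.
Proof. by move=> mn; rewrite lef_pV2 ?posrE ?root4_gt0// root4_le. Qed.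

Lemma root4V_ge0 n : 0 <= (root4 n)^-1.
Proof. by rewrite invr_ge0 root4_ge0. Qed.

(** A discrete form of the fact that x^(-1/4) is 4/3 times the derivative of x^(3/4), with 4/3
    relaxed to 2; it makes the sum of n^(-1/4) telescope. *)
Lemma root4V_step n : (root4 n.+1)^-1 <= 2 * (root4 n.+1 ^+ 3 - root4 n ^+ 3).
Proof.
have a0 := root4_gt0 n; have b0 := root4_ge0 n.
have ab := root4_le (leqnSn n).
have : root4 n.+1 ^+ 4 = root4 n ^+ 4 + 1 by rewrite !root4X4 natr1.
rewrite -[X in X <= _]mul1r ler_pdivrMr//.
set a := root4 n.+1 in a0 ab *; set b := root4 n in b0 ab *; move=> h.
have h1 : 0 <= (a ^+ 2 - b ^+ 2) ^+ 2 by exact: sqr_ge0.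
have h2 : 0 <= (a - b) * (a * b ^+ 2) by rewrite !mulr_ge0 ?subr_ge0 ?exprn_ge0// ltW.
suff : 0 <= 2 * (a ^+ 3 - b ^+ 3) * a - (a ^+ 4 - b ^+ 4) by lra.
have -> : 2 * (a ^+ 3 - b ^+ 3) * a - (a ^+ 4 - b ^+ 4) =
  (a ^+ 2 - b ^+ 2) ^+ 2 + 2 * ((a - b) * (a * b ^+ 2)) by ring.
by lra.
Qed.

Lemma sum_root4V n : \sum_(0 <= k < n) (root4 k.+1)^-1 <= 2 * root4 n ^+ 3.
Proof.
apply: (@le_trans _ _ (\sum_(0 <= k < n) 2 * (root4 k.+1 ^+ 3 - root4 k ^+ 3))).
  by apply: ler_sum_nat => k _; exact: root4V_step.
by rewrite -mulr_sumr telescope_sumr// root40 expr0n subr0.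
Qed.

(** A discrete derivative of -x^(-1/4): 1 = a^4 - b^4 = (a - b)(a^3 + a^2 b + a b^2 + b^3) is at
    most 4 (a - b) a^3. It makes the error terms of summation by parts telescope. *)
Lemma root4V_diff n :
  (root4 n.+1 * root4 n.+2 ^+ 4)^-1 <= 4 * ((root4 n.+1)^-1 - (root4 n.+2)^-1).
Proof.
have a0 := root4_gt0 n.+1; have b0 := root4_gt0 n.
have ab := root4_le (leqnSn n.+1).
have : root4 n.+2 ^+ 4 = root4 n.+1 ^+ 4 + 1 by rewrite !root4X4 natr1.
set a := root4 n.+2 in a0 ab *; set b := root4 n.+1 in b0 ab *; move=> h.
have -> : 4 * (b^-1 - a^-1) = 4 * (a - b) * a ^+ 3 / (b * a ^+ 4).
  by field; rewrite !gt_eqF.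
rewrite -[X in X <= _]mul1r ler_pM2r ?invr_gt0 ?mulr_gt0 ?exprn_gt0//.
have e1 : 1 = (a - b) * (a ^+ 3 + a ^+ 2 * b + a * b ^+ 2 + b ^+ 3).
  apply: (@eq_trans _ _ (a ^+ 4 - b ^+ 4)); first lra.
  by ring.
have -> : 4 * (a - b) * a ^+ 3 = (a - b) * (4 * a ^+ 3) by ring.
rewrite [leLHS]e1 ler_wpM2l ?subr_ge0//.
have h2 : a ^+ 2 * b <= a ^+ 2 * a by rewrite ler_wpM2l// exprn_ge0// ltW.
have h3 : b ^+ 2 <= a ^+ 2 by rewrite ler_pXn2r// nnegrE ltW.
have h4 : a * b ^+ 2 <= a * a ^+ 2 by rewrite ler_wpM2l// ltW.
have h5 : b ^+ 3 <= a ^+ 3 by rewrite ler_pXn2r// nnegrE ltW.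
have -> : 4 * a ^+ 3 = a ^+ 3 + a ^+ 2 * a + a * a ^+ 2 + a ^+ 3 by ring.
by lra.
Qed.

Lemma root4_cvg0 : (root4 n)^-1 @[n --> \oo] --> (0 : R).
Proof.
apply/cvgrPdist_le => e e0.
exists (Num.truncn (e^-1 ^+ 4)).+1 => //= n /= hn.
rewrite sub0r normrN ger0_norm ?root4V_ge0//.
case: n hn => // n hn.
rewrite -[leRHS]invrK lef_pV2 ?posrE ?invr_gt0 ?root4_gt0//.
rewrite -(@ler_pXn2r _ 4)// ?nnegrE ?invr_ge0 ?(ltW e0) ?root4_ge0// root4X4.
by rewrite (le_trans (ltW (truncnS_gt _)))// ler_nat.
Qed.

Lemma root4_rate_cvg0 (D : R) : D / root4 n.+1 @[n --> \oo] --> (0 : R).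
Proof.
rewrite -[X in _ --> X](mulr0 D); apply: cvgM; first exact: cvg_cst.
by have := root4_cvg0; rewrite -(cvg_shiftS (fun n => (root4 n)^-1)).
Qed.

Lemma root4_rate_sqr_cvg0 (D : R) : (D / root4 n.+1) ^+ 2 @[n --> \oo] --> (0 : R).
Proof.
rewrite -[X in _ --> X](mulr0 0).
by apply: cvgM; exact: root4_rate_cvg0.
Qed.

End FourthRoot.
Arguments root4 {R} n.

(** * Summation by parts from partial sums of order N^(3/4) *)

Section AbelSummation.
Context {R : realType}.
Variables (z : nat -> R[i]) (C : R).
Hypothesis C_ge0 : 0 <= C.
Let S n := \sum_(0 <= k < n) z k.
Hypothesis S_le : forall n, nc (S n) <= C * root4 n ^+ 3.

Lemma abel_sum_from (c : nat -> R[i]) M N : (M <= N)%N ->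
  \sum_(M <= k < N) z k * c k =
  S N * c N - S M * c M - \sum_(M <= k < N) S k.+1 * (c k.+1 - c k).
Proof.
elim: N => [|N IH]; first by rewrite leqn0 => /eqP ->; rewrite !big_geq// subrr subr0.
rewrite leq_eqVlt => /orP[/eqP->|MN]; first by rewrite !big_geq// subrr subr0.
rewrite big_nat_recr//= IH// [in RHS]big_nat_recr//=.
have -> : S N.+1 = S N + z N by rewrite /S big_nat_recr.
by ring.
Qed.

(** Dividing partial sums of order n^(3/4) by n leaves n^(-1/4). The two boundary terms contribute 2
    C and the telescoping remainder 4 C. *)
Lemma tail_bound M N : (M <= N)%N ->
  nc (\sum_(M <= k < N) z k / k.+1%:R) <= 6 * C / root4 M.+1.
Proof.
move=> MN; rewrite abel_sum_from//.
have eS n : nc (S n / n.+1%:R) <= C / root4 n.+1.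
  rewrite ncM ncV nc_nat ler_pdivrMr// (le_trans (S_le n))//.
  rewrite -mulrA ler_wpM2l// -(root4X4 n.+1) (exprS _ 3) mulKf ?gt_eqF ?root4_gt0//.
  by rewrite ler_pXn2r ?nnegrE ?root4_ge0// root4_le.
have h k : (M <= k < N)%N -> nc (S k.+1 * (k.+2%:R^-1 - k.+1%:R^-1)) <=
    C * 4 * ((root4 k.+1)^-1 - (root4 k.+2)^-1).
  move=> _; have -> : (k.+2%:R^-1 - k.+1%:R^-1 : R[i]) = - (k.+1%:R * k.+2%:R)^-1.
    rewrite invrB_div ?pnatr_eq0//.
    have -> : k.+1%:R - k.+2%:R = -1 :> R[i] by rewrite -[k.+2%:R]natr1; ring.
    by rewrite invfM mulN1r mulNr mulrC.
  rewrite ncM ncN ncV ncM !nc_nat.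
  apply: (@le_trans _ _ (C * (root4 k.+1 * root4 k.+2 ^+ 4)^-1)); last first.
    by rewrite -mulrA ler_wpM2l// root4V_diff.
  rewrite -(root4X4 k.+1) -(root4X4 k.+2) ler_pdivrMr; last first.
    by rewrite mulr_gt0// exprn_gt0// root4_gt0.
  apply: (le_trans (S_le _)).
  have -> // : C / (root4 k.+1 * root4 k.+2 ^+ 4) * (root4 k.+1 ^+ 4 * root4 k.+2 ^+ 4) =
     C * root4 k.+1 ^+ 3 :> R.
  by field; rewrite !gt_eqF ?root4_gt0.
have hs := nc_sum_nat h.
have tl : \sum_(M <= k < N) C * 4 * ((root4 k.+1)^-1 - (root4 k.+2)^-1) =
     C * 4 * ((root4 M.+1)^-1 - (root4 N.+1)^-1) :> R.
  rewrite -mulr_sumr -opprB -(telescope_sumr (fun k => (root4 k.+1)^-1))//.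
  by rewrite -sumrN; congr (_ * _); apply: eq_bigr => k _; rewrite opprB.
rewrite tl in hs.
apply: (le_trans (ncB _ _)).
have := ncB (S N / N.+1%:R) (S M / M.+1%:R).
have := eS N; have := eS M.
have h1 : C / root4 N.+1 <= C / root4 M.+1 by rewrite ler_wpM2l// root4V_le.
have h2 : 0 <= C / root4 N.+1 by rewrite mulr_ge0// root4V_ge0.
lra.
Qed.

(** Meant for the weights (e^(i n d) - 1) / n with h = |d|, which turn the series into its
    increments. The boundary term gives the factor 1 and the sum of n^(-1/4) the factor 4. *)
Lemma weighted_sum_bound (b : nat -> R[i]) (h : R) N : 0 <= h ->
  (forall k, nc (b k) <= h) ->
  (forall k, nc (b k.+1 - b k) <= 2 * h / k.+2%:R) ->
  nc (\sum_(0 <= k < N) z k * b k) <= 5 * C * h * root4 N ^+ 3.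
Proof.
move=> h0 hb hd; rewrite abel_sum_from//.
have -> : S 0%N = 0 by rewrite /S big_geq.
rewrite mul0r subr0.
have hk k : (0 <= k < N)%N -> nc (S k.+1 * (b k.+1 - b k)) <= 2 * C * h * (root4 k.+1)^-1.
  move=> _; rewrite ncM.
  apply: (@le_trans _ _ (C * root4 k.+1 ^+ 3 * (2 * h / k.+2%:R))).
    by rewrite ler_pM ?nc_ge0.
  have -> : C * root4 k.+1 ^+ 3 * (2 * h / k.+2%:R) =
     2 * C * h * (root4 k.+1 ^+ 3 / k.+2%:R) by ring.
  rewrite ler_wpM2l ?mulr_ge0// ler_pdivrMr// mulrC ler_pdivlMr ?root4_gt0//.
  by rewrite -exprSr root4X4 ler_nat.
have hs := nc_sum_nat hk.
have := @sum_root4V R N; rewrite -mulr_sumr in hs => hr.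
have h2 : 2 * C * h * \sum_(0 <= i < N) (root4 i.+1)^-1 <= 2 * C * h * (2 * root4 N ^+ 3).
  by rewrite ler_wpM2l// !mulr_ge0.
have h3 : nc (S N * b N) <= C * root4 N ^+ 3 * h.
  by rewrite ncM ler_pM ?nc_ge0.
apply: (le_trans (ncB _ _)).
apply: (le_trans (lerD h3 (le_trans hs h2))).
by rewrite le_eqVlt; apply/orP; left; apply/eqP; ring.
Qed.

End AbelSummation.

(** * Exponential sums with phases sqrt n and omega(n) *)

Section DispersiveSums.
Context {R : realType}.
Implicit Types (t y : R).

(** With a, b, c the roots of x, x + 1, x + 2, the second difference is exactly 2 / ((a + b)(b +
    c)(c + a)), and each factor is at most 2 s. *)
Lemma sqrt_second_diff (x s : R) : 0 <= x -> Num.sqrt (x + 2) <= s ->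
  (4 * s ^+ 3)^-1 <=
  (Num.sqrt (x + 1) - Num.sqrt x) - (Num.sqrt (x + 2) - Num.sqrt (x + 1)).
Proof.
move=> x0 xs.
have a0 : 0 <= Num.sqrt x by exact: sqrtr_ge0.
have b0 : 0 < Num.sqrt (x + 1) by rewrite sqrtr_gt0; lra.
have ab : Num.sqrt x <= Num.sqrt (x + 1) by rewrite ler_wsqrtr//; lra.
have bc : Num.sqrt (x + 1) <= Num.sqrt (x + 2) by rewrite ler_wsqrtr//; lra.
have ea : Num.sqrt x ^+ 2 = x by rewrite sqr_sqrtr.
have eb : Num.sqrt (x + 1) ^+ 2 = x + 1 by rewrite sqr_sqrtr//; lra.
have ec : Num.sqrt (x + 2) ^+ 2 = x + 2 by rewrite sqr_sqrtr//; lra.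
move: xs a0 b0 ab bc ea eb ec.
set a := Num.sqrt x; set b := Num.sqrt (x + 1); set c := Num.sqrt (x + 2).
move=> cs a0 b0 ab bc ea eb ec.
pose P := (a + b) * (b + c) * (c + a).
have P0 : 0 < P by rewrite !mulr_gt0//; lra.
have -> : (b - a) - (c - b) = 2 / P.
  apply: (mulIf (x := P)); first by rewrite gt_eqF.
  rewrite divfK ?gt_eqF//.
  have -> : (b - a - (c - b)) * P =
      ((b ^+ 2 - a ^+ 2) * (b + c) - (c ^+ 2 - b ^+ 2) * (a + b)) * (c + a).
    by rewrite /P; ring.
  rewrite ea eb ec.
  have -> : ((x + 1 - x) * (b + c) - (x + 2 - (x + 1)) * (a + b)) * (c + a) =
      c ^+ 2 - a ^+ 2 by ring.
  by rewrite ea ec; ring.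
have s0 : 0 < s by lra.
have hP : P <= (2 * s) * (2 * s) * (2 * s).
  by rewrite /P !ler_pM ?mulr_ge0//; lra.
rewrite -[X in X <= _]mul1r ler_pdivrMr ?mulr_gt0 ?exprn_gt0// mulrAC ler_pdivlMr//.
lra.
Qed.

Lemma sqrt_first_diff (x s : R) : 0 < s -> s ^+ 2 <= x ->
  0 <= Num.sqrt (x + 1) - Num.sqrt x <= s^-1.
Proof.
move=> s0 sx; have x0 : 0 <= x by rewrite (le_trans _ sx)// sqr_ge0.
have ab : Num.sqrt x <= Num.sqrt (x + 1) by rewrite ler_wsqrtr//; lra.
have sa : s <= Num.sqrt x.
  by rewrite -[s]ger0_norm ?(ltW s0)// -sqrtr_sqr ler_wsqrtr.
have ea : Num.sqrt x ^+ 2 = x by rewrite sqr_sqrtr.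
have eb : Num.sqrt (x + 1) ^+ 2 = x + 1 by rewrite sqr_sqrtr//; lra.
move: ab sa ea eb; set a := Num.sqrt x; set b := Num.sqrt (x + 1).
move=> ab sa ea eb; rewrite subr_ge0 ab/= -[s^-1]mul1r ler_pdivlMr//.
have e1 : (b - a) * (b + a) = 1.
  have -> : (b - a) * (b + a) = b ^+ 2 - a ^+ 2 by ring.
  by rewrite ea eb; ring.
rewrite -e1 ler_wpM2l//; lra.
Qed.

Lemma reduce_mod_2pi y : exists (y' : R) (m : int),
  y = y' + m%:~R * (2 * pi) /\ `|y'| <= pi.
Proof.
have p0 := @pi_gt0 R.
pose m := Num.floor (y / (2 * pi) + 2^-1).
exists (y - m%:~R * (2 * pi)), m; split; first by rewrite subrK.
have /andP[] := floor_itv (y / (2 * pi) + 2^-1); rewrite -/m intrD => h1 h2.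
have pp : 0 < 2 * pi :> R by rewrite mulr_gt0.
move: h1 h2; rewrite -(ler_pM2r pp) -(ltr_pM2r pp) => h1 h2.
have e3 : (y / (2 * pi) + 2^-1) * (2 * pi) = y + pi.
  by rewrite [LHS]mulrDl divfK ?gt_eqF//; lra.
rewrite e3 in h1 h2.
by rewrite ler_norml; apply/andP; split; lra.
Qed.

Lemma root4_sqrt_sum_pos t : 0 < t -> exists2 C : R, 0 <= C & forall N y,
  nc (\sum_(0 <= k < N) expi (t * Num.sqrt k.+1%:R + k.+1%:R * y)) <=
  C * root4 N ^+ 3.
Proof.
(* From index t^2 on, t times a first difference of sqrt is at most 1, so that the phase increments
   stay below pi + 1 after reduction of [y]. The first [N0] terms are bounded trivially. *)
move=> t0; pose N0 := (Num.truncn (t ^+ 2)).+1.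
have hN0 : t ^+ 2 <= N0%:R by exact/ltW/truncnS_gt.
exists (121 + 64 / t + N0%:R).
  by rewrite !addr_ge0// divr_ge0// ltW.
move=> N y; have [->|] := posnP N; first by rewrite big_geq// nc0 root40 expr0n mulr0.
case: N => // N' _; set N := N'.+1.
have r1 : 1 <= root4 N :> R := root4_ge1 N'.
have r3 : 1 <= root4 N ^+ 3 :> R by rewrite exprn_ege1.
have triv n (F : nat -> R) : nc (\sum_(0 <= k < n) expi (F k)) <= n%:R.
  apply: (@le_trans _ _ (\sum_(0 <= k < n) 1)).
    by apply: nc_sum_nat => k _; rewrite nc_expi.
  by rewrite sumr_const_nat subn0.
have c0 : 0 <= 121 + 64 / t by rewrite addr_ge0// divr_ge0// ltW.
have [NN|NN] := leqP N N0.
  apply: (le_trans (triv _ _)).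
  rewrite -[leLHS]mulr1 ler_pM//.
  by rewrite (@le_trans _ _ N0%:R)// ?ler_nat//; lra.
rewrite (big_cat_nat (n := N0))//=; last exact: ltnW.
apply: (le_trans (ncD _ _)).
rewrite mulrDl addrC lerD//; last first.
  by rewrite (le_trans (triv _ _))// ler_peMr.
have [y' [m [-> hy]]] := reduce_mod_2pi y.
rewrite -{1}[N0]add0n big_addn.
pose x0 k : R := (k + N0).+1%:R.
pose phi k : R := t * Num.sqrt (x0 k) + x0 k * y'.
rewrite (eq_bigr (fun k => expi (phi k))); last first.
  move=> k _; rewrite /phi /x0 -[RHS](@expi_period_int _ _ ((k + N0).+1%:Z * m)).
  by congr expi; rewrite intrM /=; ring.
pose theta k := t * (Num.sqrt (x0 k + 1) - Num.sqrt (x0 k)) + y'.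
have x0S k : x0 k.+1 = x0 k + 1 by rewrite /x0 addSn natr1.
have x00 k : 0 <= x0 k by exact: ler0n.
have phiS k : phi k.+1 = phi k + theta k.
  by rewrite /phi /theta x0S; ring.
pose r : R := root4 N; have r0 : 0 < r by rewrite /r root4_gt0.
have tr k : (k.+1 < N - N0)%N -> Num.sqrt (x0 k + 2) <= 2 * r ^+ 2.
  move=> kn; rewrite root4X2 -[X in X * _]ger0_norm// -sqrtr_sqr -sqrtrM ?sqr_ge0//.
  rewrite ler_wsqrtr// -natrX -natrM /x0 -natrD ler_nat; lia.
(* The cut is N^(-3/4). The indices involved stay below 4 N, whence second differences of at least t
   / (4 (2 r^2)^3) = t / (32 r^6). *)
have := @van_der_corput _ phi theta (N - N0) (r ^- 3) (t / (32 * r ^+ 6)) phiS.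
have d1 : 0 < r ^- 3 by rewrite invr_gt0 exprn_gt0.
have d2 : 0 < t / (32 * r ^+ 6) by rewrite divr_gt0// mulr_gt0// exprn_gt0.
move=> /(_ d1 d2) H; apply: (le_trans (H _ _)).
- move=> k kn; rewrite (le_trans (ler_normD _ _))// addrC lerD//.
  have hx : t ^+ 2 <= x0 k by rewrite (le_trans hN0)// ler_nat leqW// leq_addl.
  have /andP[h1 h2] := sqrt_first_diff t0 hx.
  rewrite normrM (gtr0_norm t0) ger0_norm//.
  by rewrite -ler_pdivlMl// mulr1.
- move=> k kn; rewrite /theta x0S.
  have := sqrt_second_diff (x00 k) (tr _ kn).
  have -> : x0 k + 1 + 1 = x0 k + 2 by ring.
  have -> : 4 * (2 * r ^+ 2) ^+ 3 = 32 * r ^+ 6 by ring.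
  by move=> /(ler_wpM2l (ltW t0)); lra.
- rewrite -/r invrK.
  have -> : 2 * r ^- 3 / (t / (32 * r ^+ 6)) = 64 / t * r ^+ 3.
    by field; rewrite !gt_eqF.
  rewrite /r; move: r3; lra.
Qed.

Lemma root4_sqrt_sum t : t != 0 -> exists2 C : R, 0 <= C & forall N y,
  nc (\sum_(0 <= k < N) expi (t * Num.sqrt k.+1%:R + k.+1%:R * y)) <=
  C * root4 N ^+ 3.
Proof.
move=> t0; have [tn|tp|/eqP] := ltgtP t 0; last by rewrite (negbTE t0).
  (* Complex conjugation changes the signs of [t] and [y] and preserves the modulus. *)
  have [|C C0 H] := @root4_sqrt_sum_pos (- t); first by rewrite oppr_gt0.
  exists C => // N y; rewrite -nc_conj conjc_sum.
  rewrite (eq_bigr (fun k : nat => expi (- t * Num.sqrt k.+1%:R + k.+1%:R * - y)));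
    first exact: H.
  by move=> k _; rewrite conj_expi; congr expi; ring.
exact: root4_sqrt_sum_pos.
Qed.

Lemma gravity_dispersionN (n : int) :
  gravity_dispersion R (- n) = gravity_dispersion R n.
Proof.
rewrite /gravity_dispersion; congr Num.sqrt; rewrite /Defs.tanh mulrNz opprK.
set a := expR (- _); set b := expR _.
by rewrite [a + b]addrC -[a - b]opprB !mulNr mulrN opprK.
Qed.

Lemma gravity_dispersion0 : gravity_dispersion R 0 = 0.
Proof. by rewrite /gravity_dispersion mul0r sqrtr0. Qed.

(** The difference is sqrt x * (1 - sqrt T) with T = tanh x, and 1 - sqrt T <= 1 - T <= 1 / x. This
    crude decay is enough: its sum is of order N^(3/4), like the main term. *)
Lemma gravity_dispersion_sqrt (n : nat) :
  `|gravity_dispersion R n.+1 - Num.sqrt n.+1%:R| <= (root4 n.+1)^-1.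
Proof.
pose x : R := n.+1%:R; have x1 : 1 <= x by rewrite /x ler1n.
pose T := Defs.tanh x.
have ex : 1 + x <= expR x by exact: expR_ge1Dx.
have e0 := expR_gt0 (- x).
have eN1 : expR (- x) * expR x = 1 by rewrite -expRD addNr expR0.
have den : 0 < expR x + expR (- x) by lra.
have T1 : 1 - T = 2 * expR (- x) / (expR x + expR (- x)).
  by rewrite /T /Defs.tanh; field; rewrite gt_eqF.
have T1ge : 0 <= 1 - T by rewrite T1 divr_ge0// ?mulr_ge0// ltW.
have Tge : 0 <= T.
  by rewrite /T /Defs.tanh divr_ge0 ?(ltW den)//; nra.
have T1le : 1 - T <= x^-1.
  rewrite T1 ler_pdivrMr// ler_pdivlMl; last lra.
  have h2 : 2 * x <= expR x ^+ 2 by nra.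
  have := ler_wpM2r (ltW e0) h2.
  have -> : expR x ^+ 2 * expR (- x) = expR x * (expR (- x) * expR x) by ring.
  by rewrite eN1; lra.
have w : gravity_dispersion R n.+1 = Num.sqrt x * Num.sqrt T.
  by rewrite /gravity_dispersion sqrtrM// ler0n.
rewrite w -/x -[X in _ - X]mulr1 -mulrBr normrM ger0_norm ?sqrtr_ge0//.
have sT : Num.sqrt T <= 1 by rewrite -sqrtr1 ler_wsqrtr//; lra.
have sT0 := sqrtr_ge0 T.
have sT2 : T <= Num.sqrt T by have := sqr_sqrtr Tge; nra.
rewrite ler0_norm ?subr_le0// opprB.
have r0 : 0 < root4 n.+1 :> R := root4_gt0 n.
have r1 : 1 <= root4 n.+1 :> R := root4_ge1 n.
have xr : x = root4 n.+1 ^+ 4 by rewrite root4X4.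
rewrite -root4X2.
apply: (@le_trans _ _ (root4 n.+1 ^+ 2 * x^-1)).
  rewrite ler_wpM2l ?exprn_ge0 ?(ltW r0)//.
  by apply: le_trans T1le; rewrite lerD2l lerN2.
rewrite xr.
have -> : root4 n.+1 ^+ 2 / root4 n.+1 ^+ 4 = (root4 n.+1 * root4 n.+1)^-1 :> R.
  by field; rewrite gt_eqF.
by rewrite lef_pV2 ?posrE ?mulr_gt0// ler_peMl// ltW.
Qed.

Definition wave t y (k : nat) : R[i] :=
  expi (t * gravity_dispersion R k.+1 + k.+1%:R * y).

Lemma wave_sum_bound t : t != 0 -> exists2 C : R, 0 <= C & forall y N,
  nc (\sum_(0 <= k < N) wave t y k) <= C * root4 N ^+ 3.
Proof.
move=> t0; have [C C0 H] := root4_sqrt_sum t0.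
exists (C + 2 * `|t|); first by rewrite addr_ge0// mulr_ge0.
move=> y N; pose v (k : nat) : R[i] := expi (t * Num.sqrt k.+1%:R + k.+1%:R * y).
have -> : \sum_(0 <= k < N) wave t y k =
    \sum_(0 <= k < N) v k + \sum_(0 <= k < N) (wave t y k - v k).
  by rewrite -big_split/=; apply: eq_bigr => k _; rewrite addrC subrK.
apply: (le_trans (ncD _ _)); rewrite mulrDl lerD ?H//.
have h k : (0 <= k < N)%N -> nc (wave t y k - v k) <= `|t| * (root4 k.+1)^-1.
  move=> _; apply: (le_trans (nc_expiB_le _ _)).
  have -> : forall a b c : R, t * a + b - (t * c + b) = t * (a - c) by move=> *; ring.
  by rewrite normrM ler_wpM2l// gravity_dispersion_sqrt.
apply: (le_trans (nc_sum_nat h)).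
rewrite -mulr_sumr [2 * _]mulrC -mulrA ler_wpM2l//.
exact: sum_root4V.
Qed.

Definition wave_psum t N y : R[i] := \sum_(0 <= k < N) wave t y k / k.+1%:R.

Lemma wave_psum_tail t : t != 0 -> exists2 C : R, 0 <= C & forall y M N,
  (M <= N)%N -> nc (wave_psum t N y - wave_psum t M y) <= C / root4 M.+1.
Proof.
move=> /wave_sum_bound[C C0 H]; exists (6 * C); first by rewrite mulr_ge0.
move=> y M N MN; rewrite /wave_psum (big_cat_nat (n := M))//= addrAC subrr add0r.
exact: tail_bound.
Qed.

(** An increment of the partial sum is the wave at [y] tested against (e^(i n d) - 1) / n with d = x
    - y, to which summation by parts applies. *)
Lemma wave_psum_lipschitz t : t != 0 -> exists2 C : R, 0 <= C & forall x y N,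
  nc (wave_psum t N x - wave_psum t N y) <= C * `|x - y| * root4 N ^+ 3.
Proof.
move=> /wave_sum_bound[C C0 H]; exists (5 * C); first by rewrite mulr_ge0.
move=> x y N; pose d := x - y.
pose b (k : nat) : R[i] := (expi (k.+1%:R * d) - 1) / k.+1%:R.
have -> : wave_psum t N x - wave_psum t N y = \sum_(0 <= k < N) wave t y k * b k.
  rewrite /wave_psum -sumrB; apply: eq_bigr => k _.
  rewrite /b /wave mulrA mulrBr mulr1 -expiD mulrBl.
  by congr (expi _ / _ - _); rewrite /d; ring.
have nz k : (k.+1%:R : R[i]) != 0 by rewrite pnatr_eq0.
apply: weighted_sum_bound => //.
- move=> k; rewrite /b ncM ncV nc_nat ler_pdivrMr//.
  rewrite (le_trans (nc_expiB1_ub _))// normrM mulrC.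
  by rewrite (ger0_norm (ler0n _ _)).
- move=> k; rewrite /b.
  (* Over the common denominator, both terms of the numerator are at most (k + 1) |d| in modulus;
     this yields the decay 2 |d| / (k + 2). *)
  have -> : (expi (k.+2%:R * d) - 1) / k.+2%:R - (expi (k.+1%:R * d) - 1) / k.+1%:R =
    (k.+1%:R * (expi (k.+1%:R * d) * (expi d - 1)) - (expi (k.+1%:R * d) - 1))
      / (k.+1%:R * k.+2%:R).
    have -> : k.+2%:R * d = k.+1%:R * d + d by rewrite -natr1; ring.
    rewrite expiD.
    have e2 : k.+2%:R = k.+1%:R + 1 :> R[i] by rewrite natr1.
    have := nz k.+1; rewrite e2 => nz2.
    set E := expi (_ * d); set D := expi d; move: nz2 (nz k).
    by move: (k.+1%:R : R[i]) => a a0 a1; field; rewrite a0 a1.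
  rewrite ncM ncV ncM !nc_nat.
  apply: (@le_trans _ _ (2 * (k.+1%:R * `|d|) / (k.+1%:R * k.+2%:R))); last first.
    have : (k.+1%:R : R) != 0 by rewrite pnatr_eq0.
    have : (k.+2%:R : R) != 0 by rewrite pnatr_eq0.
    move: (k.+1%:R : R) (k.+2%:R : R) => a c c0 a0.
    suff -> : 2 * (a * `|d|) / (a * c) = 2 * `|d| / c by [].
    by field; rewrite a0 c0.
  rewrite ler_wpM2r ?invr_ge0 ?mulr_ge0//.
  apply: (le_trans (ncB _ _)); rewrite 2!ncM nc_nat nc_expi mul1r.
  have h1 := nc_expiB1_ub d; have h2 := nc_expiB1_ub (k.+1%:R * d).
  rewrite normrM ger0_norm// in h2.
  have h3 : k.+1%:R * nc (expi d - 1) <= k.+1%:R * `|d| by rewrite ler_wpM2l.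
  by lra.
Qed.

End DispersiveSums.

(** * Fourier coefficients of step functions *)

Section StepFourier.
Context {R : realType}.
Local Notation mu := (@lebesgue_measure R).
Local Notation cell := (@period_cell R).

Lemma measurable_cell : measurable cell.
Proof. exact: measurable_itv. Qed.

Lemma integrable_cell_indic (f : R -> R) (J : set R) :
  continuous f -> measurable J ->
  mu.-integrable cell (EFin \o (fun x => f x * \1_J x)).
Proof.
move=> cf mJ; have -> : (fun x => f x * \1_J x) = f \_ J by rewrite patch_indic.
rewrite -restrict_EFin; apply/(integrable_restrict mu mJ measurable_cell).
have icc : mu.-integrable `[0, 2 * pi] (EFin \o f).
  apply: continuous_compact_integrable; first exact: segment_compact.
  exact: continuous_subspaceT.
apply: integrableS icc => //.
- by apply: measurableI => //; exact: measurable_cell.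
- move=> x [/= + _]; rewrite /period_cell/= !in_itv/= => /andP[-> /ltW ->].
  by [].
Qed.

(** The endpoints are clamped to [0, 2 pi] by [lo]. Excluding the clamped endpoints removes the
    distinction between open and closed ends. *)
Lemma interval_trace (J : interval R) : exists al be : R,
  [/\ 0 <= al, al <= be, be <= 2 * pi &
      forall x, 0 < x < 2 * pi -> x != al -> x != be ->
        (x \in J) = (al < x < be)].
Proof.
have p2 : 0 <= 2 * pi :> R by rewrite mulr_ge0// pi_ge0.
pose lo (b : itv_bound R) := match b with
  | BSide _ x => Num.min (Num.max x 0) (2 * pi)
  | BInfty true => 0 | BInfty false => 2 * pi end.
have lo0 b : 0 <= lo b.
  by case: b => [? x|[]]//=; rewrite le_min p2 le_max lexx orbT.
have lo2 b : lo b <= 2 * pi by case: b => [? x|[]]//=; rewrite ge_min lexx orbT.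
(* The maximum turns an interval whose ends are in the wrong order into the empty one with
   [al = be]. *)
case: J => l u; exists (lo l), (Num.max (lo l) (lo u)); split => //.
- by rewrite le_max lexx.
- by rewrite ge_max !lo2.
- move=> x /andP[x0 x2] xl xu.
  have hl : (l <= BLeft x)%O = (lo l < x).
    rewrite lt_neqAle eq_sym xl/=; case: l xl {xu} => [[] a|[]]//=.
    + rewrite bnd_simp => ax; rewrite ge_min ge_max (ltW x0) andbT.
      by rewrite (leNgt (2 * pi)) x2 orbF.
    + rewrite bnd_simp => ax; rewrite ge_min ge_max (ltW x0) andbT.
      rewrite (leNgt (2 * pi)) x2 orbF lt_neqAle; case: eqVneq => //= eax.
      move: ax; rewrite -eax eq_sym; move: x0 x2; rewrite -eax => x0 x2.
      by rewrite max_l ?(ltW x0)// min_l ?(ltW x2)// eqxx.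
    + by move=> _; rewrite (ltW x0).
    + by move=> _; rewrite (leNgt (2 * pi)) x2.
  rewrite itv_boundlr hl; case: (ltP (lo l) x) => [lx|//].
  rewrite /= lt_max (ltNge x (lo l)) (ltW lx)/=.
  have xu' : x != lo u.
    by apply: contraNneq xu => e; rewrite -e max_r// ltW.
  rewrite lt_neqAle xu'/=; case: u {xu hl} xu' => [[] a|[]]//=; rewrite ?bnd_simp.
  + rewrite le_min (ltW x2) andbT le_max (leNgt x 0) x0 orbF => xa.
    rewrite lt_neqAle; case: eqVneq => //= eax; move: xa; rewrite -eax.
    by rewrite max_l ?(ltW x0)// min_l ?(ltW x2)// eqxx.
  + by rewrite le_min (ltW x2) andbT le_max (leNgt x 0) x0 orbF.
  + by rewrite (leNgt x 0) x0.
  + by rewrite (ltW x2).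
Qed.

Lemma negligible_finite (s : seq R) : mu.-negligible [set` s].
Proof.
have cs : countable [set` s] by apply: finite_set_countable; exact: finite_seq.
apply/negligibleP; last exact: countable_lebesgue_measure0.
exact: countable_measurable.
Qed.

Lemma Rintegral_cell_indic (F f : R -> R) (J : interval R) (al be : R) :
  (forall x : R, is_derive x 1 F (f x)) -> continuous f ->
  0 <= al -> al <= be -> be <= 2 * pi ->
  (forall x, 0 < x < 2 * pi -> x != al -> x != be ->
        (x \in J) = (al < x < be)) ->
  Rintegral mu cell (fun x => f x * \1_[set` J] x) = F be - F al.
Proof.
move=> dF cf a0 ab b2 hJ.
have mJ : measurable [set` J] by exact: measurable_itv.
have mI : measurable (`]al, be[%classic : set R) by exact: measurable_itv.
have -> : Rintegral mu cell (fun x => f x * \1_[set` J] x) =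
          Rintegral mu cell (fun x => f x * \1_(`]al, be[) x).
  rewrite /Rintegral; congr fine.
  have /integrableP[m1 _] := integrable_cell_indic cf mJ.
  have /integrableP[m2 _] := integrable_cell_indic cf mI.
  (* On the cell the two integrands can differ only at 0, [al] and [be]. *)
  apply: ae_eq_integral => //; first exact: measurable_cell.
  apply: negligibleS (negligible_finite [:: 0; al; be]) => x /=.
  move=> h; rewrite !inE; apply/negPn/negP; rewrite !negb_or => /and3P[x0 xa xb].
  apply: h; rewrite /period_cell/= in_itv/= => /andP[x0' x2].
  congr (_ * _)%:E; rewrite !indicE; congr (_%:R).
  have := hJ x; rewrite lt_neqAle eq_sym x0 x0' x2 xa xb => /(_ isT isT isT) e.
  have e2 : (x \in J) = (x \in `]al, be[) by rewrite e in_itv.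
  by congr nat_of_bool; apply/idP/idP; rewrite !inE/= e2.
have -> : (fun x => f x * \1_(`]al, be[) x) = f \_ `]al, be[ by rewrite patch_indic.
rewrite -Rintegral_mkcondr.
have -> : cell `&` `]al, be[%classic = `]al, be[%classic.
  rewrite setIC; apply/setIidPl => x /=; rewrite /period_cell/= !in_itv/=.
  by move=> /andP[h1 h2]; apply/andP; split; lra.
have [e|ne] := eqVneq al be.
  by rewrite e subrr set_itvoo0 ?Rintegral_set0// -e.
have {}ab : al < be by rewrite lt_neqAle ne.
have icc : mu.-integrable `[al, be] (EFin \o f).
  apply: continuous_compact_integrable; first exact: segment_compact.
  exact: continuous_subspaceT.
have ioc : mu.-integrable `]al, be] (EFin \o f).
  apply: integrableS icc => //; exact: subset_itv_oc_cc.
have ioo : mu.-integrable `]al, be[ (EFin \o f).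
  apply: integrableS icc => //; exact: subset_itv_oo_cc.
rewrite Rintegral_itv_bndo_bndc// Rintegral_itv_obnd_cbnd//.
have cF : continuous F.
  by move=> x; apply: differentiable_continuous; apply/derivable1_diffP; exact: ex_derive.
rewrite /Rintegral (@continuous_FTC2 _ f F)//.
- exact: continuous_subspaceT.
- split => [x _||]; first exact: ex_derive.
  + apply: cvg_at_right_filter; exact: cF.
  + apply: cvg_at_left_filter; exact: cF.
- by move=> x _; rewrite derive1E derive_val.
Qed.

Lemma Rintegral_sum d (T : measurableType d) (nu : {measure set T -> \bar R})
    (D : set T) (I : Type) (f : I -> T -> R) (s : seq I) :
  measurable D -> (forall i, nu.-integrable D (EFin \o f i)) ->
  Rintegral nu D (fun x => \sum_(i <- s) f i x) =
  \sum_(i <- s) Rintegral nu D (f i).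
Proof.
move=> mD fi; rewrite /Rintegral.
under eq_integral do rewrite -sumEFin.
rewrite (integral_sum mD fi) sum_fine//.
by move=> i _; exact: (integrable_fin_num mD (fi i)).
Qed.

(** For c = a + i b, the real and imaginary parts of c e^(-i n x) have the form p cos + q sin, with
    (p, q) equal to (a, b) and (b, -a) respectively. *)
Lemma is_derive_trig (p q n x : R) : n != 0 ->
  is_derive x 1 (fun x => n^-1 * (p * sin (n * x) - q * cos (n * x)))
    (p * cos (n * x) + q * sin (n * x)).
Proof.
move=> n0; pose h (y : R) := n * y.
have dh : is_derive x 1 h n.
  have -> : h = n \*: id by [].
  by apply: is_derive_eq; rewrite /GRing.scale/= mulr1.
have ds : is_derive x 1 (sin \o h) (cos (n * x) * n) by exact: is_derive1_comp.
have dc : is_derive x 1 (cos \o h) (- sin (n * x) * n) by exact: is_derive1_comp.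
have -> : (fun x => n^-1 * (p * sin (n * x) - q * cos (n * x))) =
   n^-1 \*: (p \*: (sin \o h) - q \*: (cos \o h)) by [].
apply: is_derive_eq; rewrite /GRing.scale/=.
by field.
Qed.

Lemma continuous_trig (p q n : R) :
  continuous (fun x => p * cos (n * x) + q * sin (n * x)).
Proof.
move=> x; apply: cvgD; apply: cvgM; try exact: cvg_cst.
- apply: (@continuous_comp _ _ _ (fun x => n * x) cos).
    by apply: cvgM; [exact: cvg_cst|exact: cvg_id].
  exact: continuous_cos.
- apply: (@continuous_comp _ _ _ (fun x => n * x) sin).
    by apply: cvgM; [exact: cvg_cst|exact: cvg_id].
  exact: continuous_sin.
Qed.

Lemma Re_sum I (s : seq I) (F : I -> R[i]) :
  complex.Re (\sum_(i <- s) F i) = \sum_(i <- s) complex.Re (F i).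
Proof. exact: (@raddf_sum _ _ (@complex.Re R : Rcomplex R -> R)). Qed.

Lemma Im_sum I (s : seq I) (F : I -> R[i]) :
  complex.Im (\sum_(i <- s) F i) = \sum_(i <- s) complex.Im (F i).
Proof. exact: (@raddf_sum _ _ (@complex.Im R : Rcomplex R -> R)). Qed.

Lemma eq_complexP (x y : R[i]) :
  complex.Re x = complex.Re y -> complex.Im x = complex.Im y -> x = y.
Proof. by case: x y => ? ? [? ?] /= -> ->. Qed.

(** The same endpoints serve the pointwise formula, from which a jump is extracted, and the Fourier
    coefficients, in which that jump must be seen. The factor -i / (2 pi) is 1 / (2 pi i), from
    integrating e^(-i n x). *)
Lemma step_function_fourier (g : R -> R[i]) : step_function g ->
  exists (m : nat) (c : 'I_m -> R[i]) (al be : 'I_m -> R),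
  [/\ forall k, [/\ 0 <= al k, al k <= be k & be k <= 2 * pi],
      forall x, 0 < x < 2 * pi -> (forall k, x != al k /\ x != be k) ->
        g x = \sum_(k < m) c k * (al k < x < be k)%R%:R &
      forall n : int, n != 0 -> fourier_coef g n =
        (\sum_(k < m) (0 -i* (2 * pi)^-1) * c k *
            (expi (- (n%:~R * al k)) - expi (- (n%:~R * be k)))) / n%:~R].
Proof.
move=> [_ [m [c [I gE]]]].
have /choice[al /choice[be h]] := fun k => interval_trace (I k).
exists m, c, al, be; split.
- by move=> k; have [] := h k.
- move=> x x02 xk; rewrite gE; last first.
    by rewrite /period_cell/= in_itv/=; move/andP: x02 => [/ltW -> ->].
  apply: eq_bigr => k _; congr (_ * _); rewrite indicE; congr (_%:R).
  have [_ _ _ hk] := h k; have [xa xb] := xk k.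
  by congr nat_of_bool; rewrite -(hk _ x02 xa xb); apply/idP/idP; rewrite inE.
move=> n n0; pose N : R := n%:~R; have N0 : N != 0 by rewrite intr_eq0.
have intE (p q : 'I_m -> R) (G : R -> R) :
    (forall x, cell x -> G x =
      \sum_(k < m) (p k * cos (N * x) + q k * sin (N * x)) * \1_[set` I k] x) ->
    Rintegral mu cell G = \sum_(k < m)
      (N^-1 * (p k * sin (N * be k) - q k * cos (N * be k)) -
       N^-1 * (p k * sin (N * al k) - q k * cos (N * al k))).
  move=> hG.
  have -> : Rintegral mu cell G = Rintegral mu cell (fun x => \sum_(k < m)
      (p k * cos (N * x) + q k * sin (N * x)) * \1_[set` I k] x).
    by apply: eq_Rintegral => x; rewrite inE; exact: hG.
  rewrite Rintegral_sum; first last.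
  - move=> k; apply: integrable_cell_indic; last exact: measurable_itv.
    exact: continuous_trig.
  - exact: measurable_cell.
  apply: eq_bigr => k _; have [a0 ab b2 hk] := h k.
  rewrite (@Rintegral_cell_indic (fun x => N^-1 * (p k * sin (N * x) - q k * cos (N * x)))
    _ _ _ _ _ _ a0 ab b2 hk)//.
    by move=> x; exact: is_derive_trig.
  exact: continuous_trig.
rewrite /fourier_coef /Cintegral.
rewrite (intE (fun k => complex.Re (c k)) (fun k => complex.Im (c k))); last first.
  move=> x /gE ->; rewrite mulr_suml Re_sum; apply: eq_bigr => k _.
  rewrite !indicE; case: (c k) => a b.
  by case: (x \in _); rewrite ?mulr1 ?mulr0 ?mul0r//= cosN sinN -/N; ring.
rewrite (intE (fun k => complex.Im (c k)) (fun k => - complex.Re (c k))); last first.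
  move=> x /gE ->; rewrite mulr_suml Im_sum; apply: eq_bigr => k _.
  rewrite !indicE; case: (c k) => a b.
  by case: (x \in _); rewrite ?mulr1 ?mulr0 ?mul0r//= cosN sinN -/N; ring.
have -> : n%:~R = N%:C :> R[i] by rewrite rmorph_int.
have -> : forall S T : 'I_m -> R, (\sum_(k < m) S k) +i* (\sum_(k < m) T k) =
    \sum_(k < m) (S k +i* T k).
  by move=> S T; apply: eq_complexP; rewrite ?Re_sum ?Im_sum.
rewrite -fmorphV mulr_sumr mulr_suml; apply: eq_bigr => k _.
case: (c k) => a b; rewrite -/N /expi !cosN !sinN.
have pi0 : 2 * pi != 0 :> R by rewrite mulf_neq0// gt_eqF// pi_gt0.
by apply: eq_complexP => /=; ring.
Qed.

End StepFourier.

(** * Jumps, their energy in the Fourier coefficients, and discrete Parseval *)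

Section JumpEnergy.
Context {R : realType}.

Lemma sum_pred1_lt (V : nzRingType) (E : seq R) (a x : R) : uniq E -> a \in E ->
  ((a < x)%R%:R : V) = \sum_(p <- E | p < x) (a == p)%:R.
Proof.
move=> uE aE; rewrite big_mkcond/= (bigD1_seq a)//= eqxx big1 ?addr0.
  by case: ifP.
by move=> p /negbTE; rewrite eq_sym => ->; case: ifP.
Qed.

(** Off the finitely many endpoints, [g x] is the sum of the jumps located at points below [x]. If
    none of them lies in ]0, 2 pi[, only the contribution of 0 remains, and [g] is almost everywhere
    equal to that constant. *)
Lemma nonconstant_jump (g : R -> R[i]) m (c : 'I_m -> R[i]) (al be : 'I_m -> R) :
  non_constant g ->
  (forall k, [/\ 0 <= al k, al k <= be k & be k <= 2 * pi]) ->
  (forall x, 0 < x < 2 * pi -> (forall k, x != al k /\ x != be k) ->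
        g x = \sum_(k < m) c k * (al k < x < be k)%R%:R) ->
  exists2 p : R, 0 < p < 2 * pi &
    \sum_(k < m) c k * ((al k == p)%:R - (be k == p)%:R) != 0.
Proof.
move=> gnc hab gE; apply: contrapT => hno; apply: gnc.
pose J p := \sum_(k < m) c k * ((al k == p)%:R - (be k == p)%:R).
have J0 p : 0 < p < 2 * pi -> J p = 0.
  move=> hp; apply/eqP; apply: contra_notT hno => hJ.
  by exists p.
pose E := undup (0 :: codom al ++ codom be).
have uE : uniq E by exact: undup_uniq.
have alE k : al k \in E by rewrite mem_undup inE mem_cat codom_f orbT.
have beE k : be k \in E by rewrite mem_undup inE mem_cat codom_f !orbT.
have E0 : 0 \in E by rewrite mem_undup inE eqxx.
have Ege p : p \in E -> 0 <= p.
  rewrite mem_undup inE mem_cat => /orP[/eqP->//|/orP[]/codomP[k ->]].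
    by have [] := hab k.
  by have [a0 ab _] := hab k; exact: le_trans ab.
exists (J 0).
apply: negligibleS (negligible_finite E) => x /=.
move=> h; apply/negPn/negP => xE; apply: h.
rewrite /period_cell/= in_itv/= => /andP[x0 x2].
have {}x0 : 0 < x.
  by rewrite lt_neqAle x0 andbT; apply: contraNneq xE => <-.
rewrite gE ?x0//; last first.
  by move=> k; split; apply: contraNneq xE => ->.
(* Each indicator of ]al, be[ is written as the opening endpoints below [x] minus the closing ones;
   exchanging the sums then groups the coefficients by jump point. *)
transitivity (\sum_(k < m) \sum_(p <- E | p < x) c k * ((al k == p)%:R - (be k == p)%:R)).
  apply: eq_bigr => k _; rewrite -mulr_sumr sumrB -!sum_pred1_lt//; congr (_ * _).
  have [_ ab _] := hab k.
  have [ax|ax] := ltP (al k) x; last first.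
    by rewrite (ltNge (be k)) (le_trans ax ab) subrr.
  have -> : (x < be k) = ~~ (be k < x).
    rewrite -leNgt [RHS]le_eqVlt.
    by case: eqVneq => // e; move: xE; rewrite e beE.
  by case: (be k < x); rewrite ?subrr ?subr0.
rewrite exchange_big/= big_mkcond (bigD1_seq 0)//= x0.
rewrite [X in _ + X]big_seq_cond [X in _ + X]big1 ?addr0//.
move=> p /andP[pE p0]; case: ifP => // px; apply: J0.
by rewrite lt_neqAle eq_sym p0 Ege//= (lt_trans px).
Qed.

Lemma expi_neq1 (y : R) : y != 0 -> `|y| < 2 * pi -> expi y - 1 != 0.
Proof.
move=> y0 hy; rewrite -nc_eq0 nc_expiB1 mulf_neq0// normr_eq0.
wlog yp : y y0 hy / 0 < y.
  move=> H; have [yn|yp|e] := ltgtP y 0; last by rewrite e eqxx in y0.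
    have := H (- y); rewrite mulNr sinN !oppr_eq0 normrN oppr_gt0; exact.
  exact: H y0 hy yp.
rewrite gtr0_norm// in hy.
by rewrite gt_eqF// sin_gt0_pi//; apply/andP; split; lra.
Qed.

Lemma geometric_bound (y : R) P : `|y| < 2 * pi ->
  nc (\sum_(0 <= k < P) expi (k.+1%:R * y) - P%:R * (y == 0)%:R) <=
  2 / nc (expi y - 1).
Proof.
(* At [y = 0] the right-hand side is 2 / 0 = 0, and the subtracted main term [P] cancels the sum
   exactly. *)
move=> hy; have [->|y0] := eqVneq y 0.
  rewrite (eq_bigr (fun=> 1)); last by move=> k _; rewrite mulr0 expi0.
  by rewrite sumr_const_nat subn0 mulr1 subrr nc0 divr_ge0// nc_ge0.
rewrite mulr0 subr0; have w1 := expi_neq1 y0 hy.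
rewrite ler_pdivlMr ?lt_neqAle ?nc_ge0 ?andbT 1?eq_sym ?nc_eq0//.
rewrite -ncM mulr_suml.
rewrite (eq_bigr (fun k : nat => expi (k.+2%:R * y) - expi (k.+1%:R * y))); last first.
  move=> k _; rewrite mulrBr mulr1 -expiD; congr (expi _ - _).
  by rewrite -[k.+2%:R]natr1; ring.
rewrite (telescope_sumr (fun k : nat => expi (k.+1%:R * y)))//.
by rewrite (le_trans (ncB _ _))// !nc_expi.
Qed.

(* Testing against [expi (n p)] isolates the jump at [p]: the other endpoints
   contribute geometric sums, which stay bounded. *)
Lemma jump_energy m (b : 'I_m -> R[i]) (al be : 'I_m -> R) (p : R) :
  (forall k, [/\ 0 <= al k, al k <= be k & be k <= 2 * pi]) ->
  0 < p < 2 * pi ->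
  \sum_(k < m) b k * ((al k == p)%:R - (be k == p)%:R) != 0 ->
  exists2 kappa : R, 0 < kappa & exists P0 : nat, forall P, (P0 <= P)%N ->
    kappa * P%:R <= \sum_(0 <= n < P)
      nc (\sum_(k < m) b k * (expi (- (n.+1%:R * al k)) - expi (- (n.+1%:R * be k)))) ^+ 2.
Proof.
move=> hab /andP[p0 p2]; set a := \sum_(k < m) _ => a0.
pose s := nc a; have s0 : 0 < s by rewrite lt_neqAle nc_ge0 andbT eq_sym nc_eq0.
(* A bound, independent of [P], for all the geometric sums; endpoints equal to [p] enter as 2 / 0 =
   0. *)
pose B := \sum_(k < m) nc (b k) *
  (2 / nc (expi (p - al k) - 1) + 2 / nc (expi (p - be k) - 1)).
have B0 : 0 <= B.
  by apply: sumr_ge0 => k _; rewrite mulr_ge0 ?nc_ge0// addr_ge0// divr_ge0// nc_ge0.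
exists (s ^+ 2 / 2); first by rewrite divr_gt0// exprn_gt0.
(* Beyond this threshold [B] is at most a quarter of the main term [P s]. *)
exists (Num.truncn (4 * B / s)).+1 => P hP.
pose A (n : nat) := \sum_(k < m) b k * (expi (- (n.+1%:R * al k)) - expi (- (n.+1%:R * be k))).
rewrite -/A.
pose T := \sum_(0 <= n < P) A n * expi (n.+1%:R * p).
pose G y := \sum_(0 <= n < P) expi (n.+1%:R * y) : R[i].
have TE : T = \sum_(k < m) b k * (G (p - al k) - G (p - be k)).
  rewrite /T; under eq_bigr do rewrite mulr_suml.
  rewrite exchange_big/=; apply: eq_bigr => k _.
  rewrite /G -sumrB mulr_sumr; apply: eq_bigr => n _.
  rewrite -mulrA; congr (_ * _); rewrite mulrBl -!expiD.
  by congr (expi _ - expi _); ring.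
have hT : nc (T - P%:R * a) <= B.
  rewrite TE /a mulr_sumr -sumrB; apply: (le_trans (nc_sum _ _ _)).
  apply: ler_sum => k _; have [a1 a2 a3] := hab k.
  have g1 : `|p - al k| < 2 * pi by rewrite ltr_norml; apply/andP; split; lra.
  have g2 : `|p - be k| < 2 * pi by rewrite ltr_norml; apply/andP; split; lra.
  have := geometric_bound P g1; have := geometric_bound P g2.
  rewrite -/(G _) -/(G _) !subr_eq0 !(eq_sym p) => h2 h1.
  have -> : b k * (G (p - al k) - G (p - be k)) -
      P%:R * (b k * ((al k == p)%:R - (be k == p)%:R)) =
      b k * ((G (p - al k) - P%:R * (al k == p)%:R) - (G (p - be k) - P%:R * (be k == p)%:R)).
    by ring.
  by rewrite ncM ler_wpM2l ?nc_ge0// (le_trans (ncB _ _))// lerD.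
have hT2 : nc T <= \sum_(0 <= n < P) nc (A n).
  by apply: nc_sum_nat => n _; rewrite ncM nc_expi mulr1.
(* The inequality x <= x^2 / (2 s) + s / 2 passes from first powers to squares at the cost of half
   of the main term [P s]. After [B] takes a quarter, a quarter is left. *)
have hA : \sum_(0 <= n < P) nc (A n) <=
    \sum_(0 <= n < P) ((2 * s)^-1 * nc (A n) ^+ 2 + s / 2).
  apply: ler_sum_nat => n _.
  have -> : (2 * s)^-1 * nc (A n) ^+ 2 + s / 2 =
     nc (A n) + (nc (A n) - s) ^+ 2 / (2 * s).
    by field; rewrite gt_eqF.
  by rewrite lerDl divr_ge0 ?sqr_ge0// mulr_ge0// ltW.
move: hA; rewrite big_split/= -mulr_sumr sumr_const_nat subn0 -[_ *+ P]mulr_natr.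
set Q := \sum_(0 <= i < P) _ ^+ 2 => hA.
have hPs : 4 * B <= P%:R * s.
  rewrite -ler_pdivrMr// (le_trans (ltW (truncnS_gt _)))// ler_nat//.
have hPa : P%:R * s <= nc T + B.
  have : nc (P%:R * a) <= nc T + nc (T - P%:R * a).
    have e : P%:R * a = T - (T - P%:R * a) by ring.
    by rewrite [X in nc X <= _]e ncB.
  by rewrite ncM nc_nat -/s; lra.
have : P%:R * s <= (2 * s)^-1 * Q + s / 2 * P%:R + B by lra.
move=> h; have h3 : P%:R * s / 4 <= (2 * s)^-1 * Q by lra.
rewrite ler_pdivlMl ?mulr_gt0// in h3.
lra.
Qed.

Lemma orthogonality (K : nat) (i j : nat) : (i < K)%N -> (j < K)%N ->
  \sum_(0 <= l < K) expi (i%:R * (2 * pi * l%:R / K%:R)) *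
     conjc (expi (j%:R * (2 * pi * l%:R / K%:R))) = (if i == j then K%:R else 0) :> R[i].
Proof.
move=> iK jK; have K0 : (0 < K%:R :> R) by rewrite ltr0n (leq_ltn_trans _ iK).
have p0 := @pi_gt0 R.
pose y : R := (i%:R - j%:R) * (2 * pi) / K%:R.
rewrite (eq_bigr (fun l => expi y ^+ l)); last first.
  move=> l _; rewrite conj_expi -expiD -expiMn; congr expi.
  by rewrite -mulr_natr /y; ring.
case: eqVneq => [e|ne].
  have -> : y = 0 by rewrite /y e subrr !mul0r.
  rewrite expi0 (eq_bigr (fun=> 1)); last by move=> l _; rewrite expr1n.
  by rewrite sumr_const_nat subn0.
have y0 : y != 0.
  apply: mulf_neq0; last by rewrite invr_neq0// gt_eqF.
  apply: mulf_neq0; last by rewrite gt_eqF// mulr_gt0.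
  by rewrite subr_eq0 eqr_nat.
have y2 : `|y| < 2 * pi.
  have tp : 0 < 2 * pi :> R by rewrite mulr_gt0.
  rewrite /y normrM normfV (gtr0_norm K0) normrM (gtr0_norm tp).
  rewrite ltr_pdivrMr// mulrC (ltr_pM2l tp) ltr_norml.
  have : (i%:R < K%:R :> R) by rewrite ltr_nat.
  have : (j%:R < K%:R :> R) by rewrite ltr_nat.
  have : (0 <= i%:R :> R) by [].
  have : (0 <= j%:R :> R) by [].
  by move=> *; apply/andP; split; lra.
apply: (mulfI (expi_neq1 y0 y2)); rewrite mulr0 big_mkord -subrX1 -expiMn.
have -> : y *+ K = 0 + (i%:Z - j%:Z)%:~R * (2 * pi).
  by rewrite -[y *+ K]mulr_natr /y divfK ?gt_eqF// intrB add0r.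
by rewrite expi_period_int expi0 subrr.
Qed.

(** Orthogonality of the characters of Z / K. The condition [n <= K] keeps the frequencies distinct
    modulo K, so that there is no aliasing. *)
Lemma discrete_parseval (K n : nat) (d : nat -> R[i]) : (n <= K)%N ->
  \sum_(0 <= l < K) nc (\sum_(0 <= k < n) d k * expi (k%:R * (2 * pi * l%:R / K%:R))) ^+ 2
  = K%:R * \sum_(0 <= k < n) nc (d k) ^+ 2.
Proof.
move=> nK; apply: (@complexI R); rewrite rmorphM !rmorph_sum/= rmorph_nat.
under eq_bigr do rewrite sqr_ncC conjc_sum mulr_suml.
rewrite exchange_big/= mulr_sumr; apply: eq_big_nat => k /andP[_ kn].
under eq_bigr do rewrite mulr_sumr.
rewrite exchange_big/= (bigD1_seq k) ?iota_uniq ?mem_index_iota//=.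
rewrite [X in _ + X]big_seq_cond [X in _ + X]big1.
  rewrite addr0 (eq_bigr (fun l : nat => d k * conjc (d k) * (expi (k%:R * (2 * pi * l%:R / K%:R)) *
     conjc (expi (k%:R * (2 * pi * l%:R / K%:R)))))); last first.
    by move=> l _; rewrite conjcM; ring.
  by rewrite -mulr_sumr orthogonality ?eqxx ?(leq_trans kn)// sqr_ncC mulrC.
move=> j /andP[]; rewrite mem_index_iota => /andP[_ jn] jk.
rewrite (eq_bigr (fun l : nat => d k * conjc (d j) * (expi (k%:R * (2 * pi * l%:R / K%:R)) *
     conjc (expi (j%:R * (2 * pi * l%:R / K%:R)))))); last first.
  by move=> l _; rewrite conjcM; ring.
by rewrite -mulr_sumr orthogonality ?(leq_trans kn) ?(leq_trans jn)// eq_sym (negbTE jk) mulr0.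
Qed.

End JumpEnergy.

(** * The continuous representative *)

Section UniformLimits.
Context {R : realType}.
Local Notation mu := (@lebesgue_measure R).
Local Notation cell := (@period_cell R).

(* Hoelder continuity with exponent 1/4, stated without fractional powers. *)
Definition quarter_holder (f : R -> R[i]) (C : R) : Prop :=
  forall x y q : R, 0 < q -> q <= 1 -> `|x - y| <= q ^+ 4 ->
    nc (f x - f y) <= C * q.

Lemma quarter_modulus_continuous (f : R -> R) (C : R) :
  (forall x y q : R, 0 < q -> q <= 1 -> `|x - y| <= q ^+ 4 ->
    `|f x - f y| <= C * q) -> continuous f.
Proof.
move=> h x; apply/cvgrPdist_le => e e0.
pose q := Num.min 1 (e / (`|C| + 1)).
have C1 : 0 < `|C| + 1 by rewrite ltr_wpDl.
have q0 : 0 < q by rewrite lt_min ltr01 divr_gt0.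
have q1 : q <= 1 by rewrite ge_min lexx.
exists (q ^+ 4) => /=; first exact: exprn_gt0.
move=> y /= /ltW xy; apply: (le_trans (h _ _ _ q0 q1 xy)).
have : (`|C| + 1) * q <= e.
  by rewrite -ler_pdivlMl// mulrC ge_min lexx orbT.
have := ler_norm C; nra.
Qed.

Lemma quarter_holder_Re f C : quarter_holder f C ->
  continuous (fun x => complex.Re (f x)).
Proof.
move=> h; apply: (@quarter_modulus_continuous _ C) => x y q q0 q1 xy.
by rewrite -ReB (le_trans (normr_Re_le _))// h.
Qed.

Lemma quarter_holder_Im f C : quarter_holder f C ->
  continuous (fun x => complex.Im (f x)).
Proof.
move=> h; apply: (@quarter_modulus_continuous _ C) => x y q q0 q1 xy.
by rewrite -ImB (le_trans (normr_Im_le _))// h.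
Qed.

Lemma cauchy_rate_limit (a : nat -> R) (e : nat -> R) :
  e n @[n --> \oo] --> (0 : R) ->
  (forall M N, (M <= N)%N -> `|a N - a M| <= e M) ->
  forall M, `|a M - limn a| <= e M.
Proof.
move=> e0 ae.
have ca : cvgn a.
  apply: cauchy_cvg; apply: cauchy_exP => d d0.
  have /cvgrPdist_lt /(_ _ d0) [M _ hM] := e0.
  exists (a M), M => // n /= Mn; rewrite /ball/= distrC.
  apply: (le_lt_trans (ae _ _ Mn)); have := hM M (leqnn _).
  by rewrite sub0r normrN; apply: le_lt_trans; exact: ler_norm.
move=> M; apply/ler_addgt0Pr => d d0.
have /cvgrPdist_lt /(_ _ d0) [N _ hN] := ca.
have := hN (maxn M N) (leq_maxr _ _).
have := ae M (maxn M N) (leq_maxl _ _).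
set b := a (maxn M N) => h1 h2.
have -> : a M - limn a = (a M - b) + (b - limn a) by ring.
rewrite (le_trans (ler_normD _ _))// lerD// ?(distrC (a M))// distrC.
exact: ltW.
Qed.

(** The limit is taken separately in the real and imaginary parts, which accounts for the factor
    2. *)
Lemma uniform_limit (f : nat -> R -> R[i]) (D : R) :
  (forall x M N, (M <= N)%N -> nc (f N x - f M x) <= D / root4 M.+1) ->
  exists u : R -> R[i],
    (forall x M, nc (f M x - u x) <= 2 * (D / root4 M.+1)) /\
    (forall T, (forall N, periodic (f N) T) -> periodic u T).
Proof.
move=> hf; exists (fun x => limn (fun N => complex.Re (f N x)) +i*
                       limn (fun N => complex.Im (f N x))); split; last first.
  move=> T hT x; congr (limn _ +i* limn _); apply/funext => N; congr (_ _); exact: hT.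
have e0 := root4_rate_cvg0 D.
move=> x M; apply: (le_trans (nc_le_ReIm _)); rewrite ReB ImB/= mulr2n mulrDl mul1r.
apply: lerD.
  apply: (cauchy_rate_limit e0 (a := fun N => complex.Re (f N x))) => M' N MN.
  by rewrite -ReB (le_trans (normr_Re_le _))// hf.
apply: (cauchy_rate_limit e0 (a := fun N => complex.Im (f N x))) => M' N MN.
by rewrite -ImB (le_trans (normr_Im_le _))// hf.
Qed.

(** Truncating at M close to q^(-4) balances the errors: the tail is at most D q, and the Lipschitz
    bound gives L q^4 q^(-3) = L q. *)
Lemma uniform_limit_holder (f : nat -> R -> R[i]) (u : R -> R[i]) (D L : R) :
  0 <= D -> 0 <= L ->
  (forall x M, nc (f M x - u x) <= D / root4 M.+1) ->
  (forall x y N, nc (f N x - f N y) <= L * `|x - y| * root4 N ^+ 3) ->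
  quarter_holder u (2 * D + L).
Proof.
move=> D0 L0 fu fL x y q q0 q1 xy.
pose M := Num.truncn (q^-1 ^+ 4).
have qi : 0 < q^-1 by rewrite invr_gt0.
have /andP[M1 M2] : M%:R <= q^-1 ^+ 4 < M.+1%:R.
  by apply: truncn_itv; rewrite exprn_ge0// ltW.
have r1 : root4 M <= q^-1.
  by rewrite -(@ler_pXn2r _ 4)// ?nnegrE ?root4_ge0 ?(ltW qi)// root4X4.
have r2 : q^-1 <= root4 M.+1.
  by rewrite -(@ler_pXn2r _ 4)// ?nnegrE ?root4_ge0 ?(ltW qi)// root4X4 ltW.
have h1 : D / root4 M.+1 <= D * q.
  by rewrite ler_wpM2l// -[leRHS]invrK lef_pV2 ?posrE ?root4_gt0.
have h2 : L * `|x - y| * root4 M ^+ 3 <= L * q.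
  rewrite -mulrA ler_wpM2l//.
  apply: (@le_trans _ _ (q ^+ 4 * q^-1 ^+ 3)).
    by rewrite ler_pM ?exprn_ge0 ?root4_ge0// ler_pXn2r// ?nnegrE ?root4_ge0// ltW.
  by rewrite le_eqVlt; apply/orP; left; apply/eqP; field; rewrite gt_eqF.
have -> : u x - u y = (f M x - f M y) - (f M x - u x) + (f M y - u y) by ring.
rewrite (le_trans (ncD _ _))//; have := ncB (f M x - f M y) (f M x - u x).
have := fu x M; have := fu y M; have := fL x y M; lra.
Qed.

Lemma measurable_sqr_nc (w : R -> R[i]) (A : set R) :
  continuous (fun x => complex.Re (w x)) -> continuous (fun x => complex.Im (w x)) ->
  measurable A -> measurable_fun A (fun x => nc (w x) ^+ 2 : R).
Proof.
move=> cr ci mA.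
have -> : (fun x => nc (w x) ^+ 2) =
    (fun x => complex.Re (w x) ^+ 2) \+ (fun x => complex.Im (w x) ^+ 2).
  by apply/funext => x; rewrite sqr_nc.
apply: measurable_funTS.
by apply: measurable_funD; apply: measurable_funX; apply: continuous_measurable_fun.
Qed.

Lemma continuous_ReB (v w : R -> R[i]) :
  continuous (fun x => complex.Re (v x)) -> continuous (fun x => complex.Re (w x)) ->
  continuous (fun x => complex.Re (v x - w x)).
Proof.
move=> cv cw.
have -> : (fun x => complex.Re (v x - w x)) = (fun x => complex.Re (v x) - complex.Re (w x)).
  by apply/funext => x; rewrite ReB.
by move=> x; apply: cvgB; [exact: cv|exact: cw].
Qed.

Lemma continuous_ImB (v w : R -> R[i]) :
  continuous (fun x => complex.Im (v x)) -> continuous (fun x => complex.Im (w x)) ->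
  continuous (fun x => complex.Im (v x - w x)).
Proof.
move=> cv cw.
have -> : (fun x => complex.Im (v x - w x)) = (fun x => complex.Im (v x) - complex.Im (w x)).
  by apply/funext => x; rewrite ImB.
by move=> x; apply: cvgB; [exact: cv|exact: cw].
Qed.

Lemma cell_measure : mu cell = (2 * pi)%:E.
Proof.
rewrite /period_cell lebesgue_measure_itv/= lte_fin mulr_gt0 ?pi_gt0//.
by rewrite sube0.
Qed.

Lemma uniform_cvg_L2 (f : nat -> R -> R[i]) (u : R -> R[i]) (D : R) :
  (forall N, continuous (fun x => complex.Re (f N x))) ->
  (forall N, continuous (fun x => complex.Im (f N x))) ->
  continuous (fun x => complex.Re (u x)) -> continuous (fun x => complex.Im (u x)) ->
  (forall x N, nc (f N x - u x) <= D / root4 N.+1) ->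
  (\int[mu]_(x in cell) (nc (f N x - u x) ^+ 2)%:E)%E @[N --> \oo] --> 0%E.
Proof.
move=> cfr cfi cur cui fu.
have e0 : ((D / root4 n.+1) ^+ 2 * (2 * pi))%:E @[n --> \oo] --> (0 : R)%:E.
  apply: cvg_EFin; first exact: nearW.
  rewrite -[X in _ --> X](mul0r (2 * pi)); apply: cvgM; last exact: cvg_cst.
  exact: root4_rate_sqr_cvg0.
apply: (squeeze_cvge _ (cvg_cst _) e0).
near=> N; apply/andP; split.
  by apply: integral_ge0 => x _; rewrite lee_fin sqr_ge0.
rewrite EFinM -cell_measure -integral_cst; last exact: measurable_cell.
apply: ge0_le_integral.
- exact: measurable_cell.
- by move=> x _; rewrite lee_fin sqr_ge0.
- apply/measurable_EFinP; apply: measurable_sqr_nc; last exact: measurable_cell.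
  + exact: continuous_ReB.
  + exact: continuous_ImB.
- exact: measurable_cst.
- move=> x _; rewrite /= lee_fin ler_pXn2r ?nnegrE ?nc_ge0//.
  exact: le_trans (nc_ge0 _) (fu x N).
Unshelve. all: by end_near.
Qed.

Lemma reduce_to_cell (x : R) : exists y (n : int), x = y + n%:~R * (2 * pi) /\ cell y.
Proof.
have p0 := @pi_gt0 R; have pp : 0 < 2 * pi :> R by rewrite mulr_gt0.
pose m := Num.floor (x / (2 * pi)).
exists (x - m%:~R * (2 * pi)), m; split; first by rewrite subrK.
have /andP[] := floor_itv (x / (2 * pi)); rewrite -/m intrD.
rewrite -(ler_pM2r pp) -(ltr_pM2r pp) divfK ?gt_eqF// => h1 h2.
by rewrite /period_cell/= in_itv/=; apply/andP; split; lra.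
Qed.

Lemma periodic_int (V : zmodType) (f : R -> V) (T : R) (n : int) (x : R) :
  periodic f T -> f (x + n%:~R * T) = f x.
Proof.
move=> hf; case: n => n.
  by rewrite [n%:~R * T]mulr_natl periodicn.
rewrite NegzE mulrNz mulNr [n.+1%:~R * T]mulr_natl.
by rewrite -[in RHS](subrK (T *+ n.+1) x) periodicn.
Qed.

(* Where [u] and [v] differ, continuity keeps them apart on an interval, on
   which the uniformly convergent sequence cannot approach [v] in L^2. *)
Lemma L2_limit_unique (f : nat -> R -> R[i]) (u v : R -> R[i]) (D : R) :
  (forall N, continuous (fun x => complex.Re (f N x))) ->
  (forall N, continuous (fun x => complex.Im (f N x))) ->
  continuous (fun x => complex.Re (u x)) -> continuous (fun x => complex.Im (u x)) ->
  continuous (fun x => complex.Re (v x)) -> continuous (fun x => complex.Im (v x)) ->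
  periodic u (2 * pi) -> periodic v (2 * pi) ->
  (forall x N, nc (f N x - u x) <= D / root4 N.+1) ->
  (\int[mu]_(x in cell) (nc (f N x - v x) ^+ 2)%:E)%E @[N --> \oo] --> 0%E ->
  u = v.
Proof.
move=> cfr cfi cur cui cvr cvi pu pv fu fv; apply/funext => x1.
have [x0 [n [-> x0c]]] := reduce_to_cell x1; rewrite !periodic_int// {x1 n}.
apply/eqP; rewrite -subr_eq0 -nc_eq0; apply/negP => /negP w0.
pose phi x : R := nc (u x - v x) ^+ 2.
pose d : R := phi x0; have d0 : 0 < d by rewrite exprn_gt0// lt_neqAle eq_sym w0 nc_ge0.
have cphi : continuous phi.
  have -> : phi = (fun x => complex.Re (u x - v x) * complex.Re (u x - v x)
      + complex.Im (u x - v x) * complex.Im (u x - v x)).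
    by apply/funext => x; rewrite /phi sqr_nc !expr2.
  move=> x; apply: cvgD; apply: cvgM; by [apply: continuous_ReB|apply: continuous_ImB].
have d2 : 0 < d / 2 by rewrite divr_gt0.
have /cvgrPdist_lt /(_ _ d2) [r /= r0 hr] := cphi x0.
move: (x0c); rewrite /period_cell/= in_itv/= => /andP[x00 x02].
(* The interval extends to the right of [x0], where the half-open cell always leaves room. *)
pose eta := Num.min (r / 2) (2 * pi - x0).
have eta0 : 0 < eta by rewrite lt_min divr_gt0//= subr_gt0.
have eta1 : eta <= r / 2 by rewrite ge_min lexx.
have eta2 : eta <= 2 * pi - x0 by rewrite ge_min lexx orbT.
have phige x : `[x0, x0 + eta[%classic x -> d / 2 <= phi x.
  rewrite /= in_itv/= => /andP[h1 h2].
  have : ball_ Num.Def.normr x0 r x.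
    by rewrite /= ler0_norm; lra.
  by move=> /hr; rewrite /= -/d ltr_distl => /andP[]; lra.
have c0 : 0 < d / 8 * eta by rewrite mulr_gt0// divr_gt0.
have e0 := root4_rate_sqr_cvg0 D.
(* From d / 2 <= |u - v|^2 <= 2 |f - v|^2 + 2 |f - u|^2, an error |f - u|^2 of at most d / 8 leaves
   |f - v|^2 >= d / 8 on the interval. *)
have d8 : 0 < d / 8 by rewrite divr_gt0.
have /cvgrPdist_lt /(_ _ d8) [N1 _ hN1] := e0.
have [N2 _ hN2] : \forall N \near \oo,
   (\int[mu]_(x in cell) (nc (f N x - v x) ^+ 2)%:E < (d / 8 * eta)%:E)%E.
  apply: (fv [set y | (y < (d / 8 * eta)%:E)%E]).
  by apply: open_nbhs_nbhs; split; [exact: open_ereal_lt_ereal|rewrite /= lte_fin].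
pose N := maxn N1 N2.
have := hN2 N (leq_maxr _ _); apply/negP; rewrite -leNgt.
have := hN1 N (leq_maxl _ _); rewrite sub0r normrN => /(le_lt_trans (ler_norm _)) hN.
pose I : set R := `[x0, x0 + eta[%classic.
have muI : mu I = eta%:E.
  rewrite /I lebesgue_measure_itv/= lte_fin ltrDl eta0.
  by rewrite -EFinD addrAC subrr add0r.
have mI : measurable I by exact: measurable_itv.
have -> : (d / 8 * eta)%:E = (\int[mu]_(x in I) cst (d / 8)%:E x)%E.
  by rewrite EFinM -muI -integral_cst.
have m1 (A : set R) : measurable A ->
    measurable_fun A (fun x => nc (f N x - v x) ^+ 2 : R).
  by apply: measurable_sqr_nc; [exact: continuous_ReB|exact: continuous_ImB].
apply: (@le_trans _ _ (\int[mu]_(x in I) (nc (f N x - v x) ^+ 2)%:E)%E).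
  apply: ge0_le_integral => //.
  - by move=> x _; rewrite lee_fin ltW.
  - by apply/measurable_EFinP; exact: m1.
  - move=> x /phige; rewrite lee_fin /phi => hx.
    have e : u x - v x = (f N x - v x) + - (f N x - u x) by ring.
    have := sqr_ncD_le (f N x - v x) (- (f N x - u x)); rewrite -e ncN.
    have : nc (f N x - u x) ^+ 2 <= (D / root4 N.+1) ^+ 2.
      by rewrite ler_pXn2r ?nnegrE ?nc_ge0// (le_trans (nc_ge0 _) (fu x N)).
    lra.
apply: ge0_subset_integral => //.
- exact: measurable_cell.
- apply/measurable_EFinP; apply: m1; exact: measurable_cell.
- by move=> x _; rewrite lee_fin sqr_ge0.
- move=> x; rewrite /I /period_cell/= !in_itv/= => /andP[h1 h2].
  by apply/andP; split; lra.
Qed.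

End UniformLimits.

(** * The evolved step function as a uniform limit *)

Section Evolution.
Context {R : realType}.
Local Notation mu := (@lebesgue_measure R).
Local Notation cell := (@period_cell R).
Local Notation omega := (@gravity_dispersion R).

Lemma symmetric_sum (V : zmodType) (F : int -> V) N :
  \sum_(k < (2 * N).+1) F (k%:Z - N%:Z) =
  F 0 + \sum_(0 <= k < N) (F k.+1%:Z + F (- k.+1%:Z)).
Proof.
elim: N => [|N IH].
  by rewrite muln0 big_ord1 subrr big_geq// addr0.
rewrite big_nat_recr//= addrA -IH.
have -> : (2 * N.+1).+1 = (2 * N).+3 by lia.
rewrite big_ord_recr big_ord_recl/=.
have -> : (2 * N).+2%:Z - N.+1%:Z = N.+1%:Z by lia.
have -> : 0%:Z - N.+1%:Z = - N.+1%:Z by lia.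
rewrite [LHS]addrAC [LHS]addrC [X in _ + X = _]addrC; congr (_ + _).
apply: eq_bigr => k _; congr F.
by rewrite /bump /= add1n; lia.
Qed.

Section StepData.
Variables (g : R -> R[i]) (m : nat) (b : 'I_m -> R[i]) (al be : 'I_m -> R).
Hypothesis gF : forall n : int, n != 0 -> fourier_coef g n =
  (\sum_(k < m) b k * (expi (- (n%:~R * al k)) - expi (- (n%:~R * be k)))) / n%:~R.
Variable t : R.
Hypothesis t_neq0 : t != 0.

Let W := wave_psum t.
Let D N x (y : 'I_m -> R) k := W N (x - y k) - W N (y k - x).

(** Since omega is even, the frequencies n and -n carry the same phase. The denominator -n gives the
    minus sign, and frequency -n in [x - y] is frequency n in [y - x]. *)
Lemma evolution_psumE N x : evolution_psum omega g t N x =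
  fourier_coef g 0 + \sum_(k < m) b k * (D N x al k - D N x be k).
Proof.
rewrite /evolution_psum
  (symmetric_sum (fun n => fourier_coef g n * expi (t * omega n + n%:~R * x))).
congr (_ + _); first by rewrite gravity_dispersion0 mulr0 mul0r addr0 expi0 mulr1.
rewrite /D /W /wave_psum.
under [RHS]eq_bigr do rewrite -!sumrB mulr_sumr.
rewrite exchange_big/=; apply: eq_bigr => n _.
rewrite !gF//.
rewrite gravity_dispersionN mulr_suml mulr_suml mulr_suml mulr_suml -big_split/=.
apply: eq_bigr => k _; rewrite /wave.
have -> : ((- n.+1%:Z)%:~R : R[i]) = - n.+1%:R by rewrite mulrNz.
have -> : (n.+1%:Z%:~R : R[i]) = n.+1%:R by [].
have -> : ((- n.+1%:Z)%:~R : R) = - n.+1%:R by rewrite mulrNz.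
have -> : (n.+1%:Z%:~R : R) = n.+1%:R by [].
set w := t * omega _; set N1 : R := n.+1%:R.
have e1 (y : R) : expi (w + N1 * (x - y)) = expi (- (N1 * y)) * expi (w + N1 * x).
  by rewrite -expiD; congr expi; ring.
have e2 (y : R) : expi (w + N1 * (y - x)) = expi (- (- N1 * y)) * expi (w + - N1 * x).
  by rewrite -expiD; congr expi; ring.
rewrite !e1 !e2 invrN; ring.
Qed.

Lemma evolution_psum_tail : exists2 C : R, 0 <= C & forall x M N, (M <= N)%N ->
  nc (evolution_psum omega g t N x - evolution_psum omega g t M x) <= C / root4 M.+1.
Proof.
have [C C0 hC] := wave_psum_tail t_neq0.
exists (\sum_(k < m) nc (b k) * (4 * C)).
  by apply: sumr_ge0 => k _; rewrite mulr_ge0 ?nc_ge0// mulr_ge0.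
move=> x M N MN; rewrite !evolution_psumE.
rewrite opprD addrACA subrr add0r -sumrB mulr_suml.
apply: (le_trans (nc_sum _ _ _)); apply: ler_sum => k _.
rewrite -mulrBr ncM -mulrA ler_wpM2l ?nc_ge0// /D /W.
set A := fun y : R => wave_psum t N y - wave_psum t M y.
have -> : forall a1 a2 a3 a4 b1 b2 b3 b4 : R[i],
   (a1 - a2 - (a3 - a4)) - (b1 - b2 - (b3 - b4)) =
   ((a1 - b1) - (a2 - b2)) - ((a3 - b3) - (a4 - b4)) by move=> *; ring.
have hA y : nc (A y) <= C / root4 M.+1 by exact: hC.
rewrite -/(A _) -/(A _) -/(A _) -/(A _).
apply: (le_trans (ncB _ _)).
have := ncB (A (x - al k)) (A (al k - x)); have := ncB (A (x - be k)) (A (be k - x)).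
have := hA (x - al k); have := hA (al k - x); have := hA (x - be k); have := hA (be k - x).
lra.
Qed.

Lemma evolution_psum_lipschitz : exists2 C : R, 0 <= C & forall x y N,
  nc (evolution_psum omega g t N x - evolution_psum omega g t N y) <=
  C * `|x - y| * root4 N ^+ 3.
Proof.
have [C C0 hC] := wave_psum_lipschitz t_neq0.
exists (\sum_(k < m) nc (b k) * (4 * C)).
  by apply: sumr_ge0 => k _; rewrite mulr_ge0 ?nc_ge0// mulr_ge0.
move=> x y N; rewrite !evolution_psumE.
rewrite opprD addrACA subrr add0r -sumrB 2!mulr_suml.
apply: (le_trans (nc_sum _ _ _)); apply: ler_sum => k _.
rewrite -mulrBr ncM -2!mulrA ler_wpM2l ?nc_ge0// /D /W.
have -> : forall a1 a2 a3 a4 b1 b2 b3 b4 : R[i],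
   (a1 - a2 - (a3 - a4)) - (b1 - b2 - (b3 - b4)) =
   ((a1 - b1) - (a2 - b2)) - ((a3 - b3) - (a4 - b4)) by move=> *; ring.
have h1 z := hC (x - z) (y - z) N; have h2 z := hC (z - x) (z - y) N.
have e1 (z : R) : x - z - (y - z) = x - y by ring.
have e2 (z : R) : `|z - x - (z - y)| = `|x - y|.
  by rewrite -normrN; congr `| _ |; ring.
apply: (le_trans (ncB _ _)).
have := ncB (wave_psum t N (x - al k) - wave_psum t N (y - al k))
  (wave_psum t N (al k - x) - wave_psum t N (al k - y)).
have := ncB (wave_psum t N (x - be k) - wave_psum t N (y - be k))
  (wave_psum t N (be k - x) - wave_psum t N (be k - y)).
have := h1 (al k); have := h2 (al k); have := h1 (be k); have := h2 (be k).
rewrite !e1 !e2; lra.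
Qed.

End StepData.

Lemma evolution_psum_periodic (g : R -> R[i]) (t : R) N :
  periodic (evolution_psum omega g t N) (2 * pi).
Proof.
move=> x; apply: eq_bigr => k _; congr (_ * _).
by rewrite mulrDr addrA expi_period_int.
Qed.

(** The equivalence contains existence and uniqueness at once; it later identifies the
    representative picked by [xget] with [u]. *)
Lemma evolution_limit (g : R -> R[i]) (t : R) : step_function g -> t != 0 ->
  exists u C, [/\ 0 <= C, quarter_holder u C,
    forall x N, nc (evolution_psum omega g t N x - u x) <= C / root4 N.+1 &
    forall v, continuous_representative omega g t v <-> v = u].
Proof.
move=> /step_function_fourier[m [c [al [be [_ _ gF]]]]] t0.
have [D D0 hD] := evolution_psum_tail gF t0.
have [L L0 hL] := evolution_psum_lipschitz gF t0.
have [u [hu pu]] := uniform_limit hD.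
pose C := 2 * (2 * D) + L.
have C0 : 0 <= C by rewrite addr_ge0// !mulr_ge0.
have hu' x M : nc (evolution_psum omega g t M x - u x) <= (2 * D) / root4 M.+1.
  by rewrite -mulrA.
have hC : quarter_holder u C.
  by apply: (uniform_limit_holder _ L0 hu' hL); rewrite mulr_ge0.
(* This constant grows with [N] and serves only to make the partial sums continuous. *)
have hp N : quarter_holder (evolution_psum omega g t N) (L * root4 N ^+ 3).
  move=> x y q q0 q1 xy; apply: (le_trans (hL _ _ _)).
  rewrite mulrAC ler_wpM2l ?mulr_ge0 ?exprn_ge0 ?root4_ge0//.
  by rewrite (le_trans xy)// exprS ler_piMr ?(ltW q0)// exprn_ile1// ltW.
have hu2 x M : nc (evolution_psum omega g t M x - u x) <= C / root4 M.+1.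
  by rewrite (le_trans (hu' _ _))// ler_wpM2r ?root4V_ge0// /C; lra.
have per := pu _ (evolution_psum_periodic g t).
have cr N := quarter_holder_Re (hp N); have ci N := quarter_holder_Im (hp N).
have cur := quarter_holder_Re hC; have cui := quarter_holder_Im hC.
exists u, C; split => // v; split => [[pv cvr cvi hv]|->].
  exact/esym/(L2_limit_unique cr ci cur cui cvr cvi per pv hu2 hv).
by split => //; exact: (uniform_cvg_L2 cr ci cur cui hu2).
Qed.

End Evolution.

(** * Fractal dimension of graphs *)

Section FractalDimension.
Context {R : realType}.
Implicit Types (E : set (R * R)) (f : R -> R).

Lemma covering_number_le E (e : R) (n : nat) (c : 'I_n -> R * R) :
  E `<=` [set p | exists k, plane_ball (c k) e p] ->
  (covering_number E e <= n%:R%:E)%E.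
Proof. by move=> h; apply: ereal_inf_lbound; exists n => //; exists c. Qed.

Lemma covering_number_ge0 E (e : R) : (0 <= covering_number E e)%E.
Proof.
apply: le_ereal_inf_tmp => _ [n _ <-].
by rewrite lee_fin ler0n.
Qed.

Lemma covering_number_exists E (e B : R) :
  (covering_number E e <= B%:E)%E -> exists n (c : 'I_n -> R * R),
    E `<=` [set p | exists k, plane_ball (c k) e p] /\ n%:R <= B + 1.
Proof.
move=> hB; have : (covering_number E e < (B + 1)%:E)%E.
  by rewrite (le_lt_trans hB)// lte_fin ltrDl.
move=> /ereal_inf_lt[_ [n [c hc] <-]]; rewrite lte_fin => hn.
by exists n, c; split => //; exact: ltW.
Qed.

(** The prefactor disappears in the limit: ln A / ln (1/e) <= eta as soon as e < exp (- ln A /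
    eta). *)
Lemma fractal_dimension_le E (A s : R) : 1 <= A ->
  (forall e, 0 < e -> e < 1 -> (covering_number E e <= (A * expR (s * ln e^-1))%:E)%E) ->
  (fractal_dimension E <= s%:E)%E.
Proof.
move=> A1 h; apply/lee_addgt0Pr => eta eta0.
pose d := Num.min 1 (expR (- (ln A / eta))).
have d0 : 0 < d by rewrite lt_min ltr01 expR_gt0.
have A0 : 0 < A by exact: lt_le_trans A1.
pose V : set R := [set e | 0 < e < d].
have V0 : (0 : R)^'+ V.
  near=> e; rewrite /V/=; apply/andP; split; near: e; [exact: nbhs_right_gt|exact: nbhs_right_lt].
apply: (@le_trans _ _ (ereal_sup
  ((fun e : R => (lne (covering_number E e) * ((ln e^-1)^-1)%:E)%E) @` V))).
  by apply: ereal_inf_lbound; exists V.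
apply: ge_ereal_sup => _ [e /andP[e0 ed] <-].
have e1 : e < 1 by rewrite (lt_le_trans ed)// ge_min lexx.
have ei : 1 < e^-1 by rewrite invf_gt1.
have L0 : 0 < ln e^-1 by rewrite ln_gt0.
have hL : ln A / eta <= ln e^-1.
  rewrite lnV ?posrE// lerNr -[leRHS]expRK ler_ln ?posrE ?expR_gt0//.
  by rewrite (le_trans (ltW ed))// ge_min lexx orbT.
rewrite lee_pdivrMr// -EFinD -EFinM.
apply: (@le_trans _ _ (lne (A * expR (s * ln e^-1))%:E)).
  rewrite lee_lne ?h// in_itv/= leey andbT ?covering_number_ge0//.
  by rewrite lee_fin mulr_ge0 ?expR_ge0// ltW.
rewrite lne_EFin ?mulr_gt0 ?expR_gt0// lnM ?posrE ?expR_gt0// expRK lee_fin.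
rewrite ler_pdivrMr// in hL.
rewrite mulrDl; lra.
Unshelve. all: by end_near.
Qed.

(** A limsup strictly below [s] leaves room for an [r < s] that bounds the quotient at all
    sufficiently small scales, not just along a sequence. *)
Lemma fractal_dimension_lt E (s : R) : (fractal_dimension E < s%:E)%E ->
  exists2 r : R, r < s & exists2 d : R, 0 < d & forall e, 0 < e -> e < d ->
    (covering_number E e <= (expR (r * ln e^-1))%:E)%E.
Proof.
move=> /ereal_inf_lt[_ [V V0 <-]] hs.
have [r hr rs] : exists2 r : R,
    (ereal_sup ((fun e : R =>
      (lne (covering_number E e) * ((ln e^-1)^-1)%:E)%E) @` V) <= r%:E)%E & r < s.
  move: hs; case: (ereal_sup _) => [r| |]//.
  - by rewrite lte_fin => rs; exists r.
  - by move=> _; exists (s - 1); [rewrite leNye|rewrite ltrBlDr ltrDl].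
exists r => //; move: V0 => [d /= d0 hV].
exists (Num.min d 1); first by rewrite lt_min d0 ltr01.
move=> e e0; rewrite lt_min => /andP[ed e1].
have Ve : V e by apply: hV => //=; rewrite sub0r normrN gtr0_norm.
have ei : 1 < e^-1 by rewrite invf_gt1.
have L0 : 0 < ln e^-1 by rewrite ln_gt0.
have : (lne (covering_number E e) * ((ln e^-1)^-1)%:E <= r%:E)%E.
  by apply: le_trans hr; apply: ereal_sup_ubound; exists e.
rewrite lee_pdivrMr// -EFinM.
have := covering_number_ge0 E e; case: (covering_number E e) => [x| |]//= x0.
(* A vanishing covering number, whose logarithm is not a real number, is treated apart. *)
have [x0'|x0'] := leP x 0.
  by move=> _; rewrite lee_fin (le_trans x0')// expR_ge0.
by rewrite !lee_fin -ler_expR lnK ?posrE.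
Qed.

(** At scale e = q^4 there are about q^(-4) columns, over each of which the graph has height of
    order q and so needs about q^(-3) balls: q^(-7) = e^(-7/4) in total. *)
Lemma holder_graph_covering f (C q : R) : 0 <= C -> 0 < q -> q <= 1 ->
  (forall x y, `|x - y| <= q ^+ 4 -> `|f x - f y| <= C * q) ->
  (covering_number (graph_on_torus f) (q ^+ 4) <=
    ((4 * pi + 1) * (4 * C + 3) * q^-1 ^+ 7)%:E)%E.
Proof.
move=> C0 q0 q1 hf; set e := q ^+ 4; pose dl := e / 2.
have e0 : 0 < e by exact: exprn_gt0.
have dl0 : 0 < dl by rewrite divr_gt0.
have p0 := @pi_gt0 R.
pose M := (Num.truncn (2 * pi / dl)).+1.
pose J := (Num.truncn (C * q / dl)).+1.
pose J2 := (2 * J).+1.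
(* A grid of mesh e / 2 coded by quotient and remainder of [k]; the shift by [J] centres each column
   at its left-end value. Every graph point is within e / 2 of a centre in each coordinate, hence at
   distance less than e. *)
pose c (k : 'I_(M * J2)) : R * R :=
  ((k %/ J2)%:R * dl, f ((k %/ J2)%:R * dl) + ((k %% J2)%:R - J%:R) * dl).
have hc : graph_on_torus f `<=` [set p | exists k, plane_ball (c k) e p].
  move=> [x y] [/= + ->]; rewrite /period_cell/= in_itv/= => /andP[x0 x2].
  have xd : 0 <= x / dl by rewrite divr_ge0// ltW.
  pose m := Num.truncn (x / dl).
  have /andP[m1 m2] := truncn_itv xd; rewrite -/m in m1 m2.
  have mM : (m < M)%N.
    rewrite ltnS /m le_truncn// ler_pM2r ?invr_gt0// ltW//.
  rewrite ler_pdivlMr// in m1; rewrite ltr_pdivrMr// -natr1 mulrDl mul1r in m2.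
  have hm : `|x - m%:R * dl| <= e.
    by rewrite ger0_norm ?subr_ge0// lerBlDl (le_trans (ltW m2))// lerD2l /dl; lra.
  have := hf _ _ hm; rewrite ler_norml => /andP[f1 f2].
  set s := (f x - f (m%:R * dl)) / dl + J%:R.
  have hJ : C * q < J%:R * dl by rewrite -ltr_pdivrMr// truncnS_gt.
  have s0 : 0 <= s.
    by rewrite /s -lerBlDr sub0r ler_pdivlMr// mulNr; lra.
  have s2 : s < J2%:R.
    rewrite /J2 -natr1 natrM /s.
    have : (f x - f (m%:R * dl)) / dl < J%:R by rewrite ltr_pdivrMr//; lra.
    lra.
  pose j := Num.truncn s; have /andP[j1 j2] := truncn_itv s0; rewrite -/j in j1 j2.
  have jJ : (j < J2)%N by rewrite -(ltr_nat R) (le_lt_trans j1).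
  have kK : (m * J2 + j < M * J2)%N.
    rewrite (@leq_trans (m.+1 * J2))//; first by rewrite mulSn addnC ltn_add2r.
    by rewrite leq_mul2r mM orbT.
  exists (Ordinal kK); rewrite /plane_ball /c /= divnMDl// divn_small// addn0.
  rewrite modnMDl modn_small//.
  have hx : `|x - m%:R * dl| <= dl.
    by rewrite ger0_norm ?subr_ge0// lerBlDl ltW.
  have hy : `|f x - (f (m%:R * dl) + (j%:R - J%:R) * dl)| <= dl.
    have -> : f x - (f (m%:R * dl) + (j%:R - J%:R) * dl) = (s - j%:R) * dl.
      by rewrite /s; field; rewrite gt_eqF.
    rewrite normrM (gtr0_norm dl0) ger_pMl// ger0_norm ?subr_ge0// lerBlDl.
    by rewrite natr1 ltW.
  rewrite -[ltRHS]ger0_norm ?(ltW e0)// -sqrtr_sqr ltr_sqrt ?exprn_gt0//.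
  have : (x - m%:R * dl) ^+ 2 <= dl ^+ 2.
    by rewrite -[leLHS]real_normK ?num_real// ler_pXn2r ?nnegrE// ltW.
  have : (f x - (f (m%:R * dl) + (j%:R - J%:R) * dl)) ^+ 2 <= dl ^+ 2.
    by rewrite -[leLHS]real_normK ?num_real// ler_pXn2r ?nnegrE// ltW.
  have -> : e = 2 * dl by rewrite /dl; lra.
  have : 0 < dl ^+ 2 by rewrite exprn_gt0.
  move=> a1 a2 a3; rewrite exprMn; lra.
apply: (le_trans (covering_number_le hc)); rewrite lee_fin natrM.
have qi : 1 <= q^-1 by rewrite invf_ge1.
have q3 : 1 <= q^-1 ^+ 3 by rewrite exprn_ege1.
have q4 : 1 <= q^-1 ^+ 4 by rewrite exprn_ege1.
have -> : (4 * pi + 1) * (4 * C + 3) * q^-1 ^+ 7 =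
  ((4 * pi + 1) * q^-1 ^+ 4) * ((4 * C + 3) * q^-1 ^+ 3) by ring.
have e4 : e^-1 = q^-1 ^+ 4 by rewrite exprVn.
apply: ler_pM => //.
  have /truncn_itv/andP[h1 _] : 0 <= 2 * pi / dl by rewrite divr_ge0 ?mulr_ge0// ltW.
  rewrite /M -natr1.
  have h2 : 2 * pi / dl = 4 * pi * q^-1 ^+ 4.
    by rewrite -e4 /dl; field; rewrite gt_eqF.
  rewrite [X in _ <= X]h2 in h1.
  have -> : (4 * pi + 1) * q^-1 ^+ 4 = 4 * pi * q^-1 ^+ 4 + q^-1 ^+ 4 by ring.
  lra.
have /truncn_itv/andP[h1 _] : 0 <= C * q / dl by rewrite divr_ge0 ?mulr_ge0// ltW.
have h2 : C * q / dl = 2 * C * q^-1 ^+ 3.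
  by rewrite /dl /e; field; rewrite gt_eqF.
rewrite /J2 -natr1 natrM /J -natr1; rewrite [X in _ <= X]h2 in h1.
have -> : (4 * C + 3) * q^-1 ^+ 3 = 2 * (2 * C * q^-1 ^+ 3) + 3 * q^-1 ^+ 3 by ring.
lra.
Qed.

Lemma holder_graph_dimension f (C : R) : 0 <= C ->
  (forall x y q : R, 0 < q -> q <= 1 -> `|x - y| <= q ^+ 4 ->
    `|f x - f y| <= C * q) ->
  (fractal_dimension (graph_on_torus f) <= (7 / 4)%:E)%E.
Proof.
move=> C0 hf; have p0 := @pi_gt0 R.
apply: (@fractal_dimension_le _ ((4 * pi + 1) * (4 * C + 3))).
  by rewrite -[leLHS]mulr1 ler_pM//; lra.
move=> e e0 e1; pose q := Num.sqrt (Num.sqrt e).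
have q0 : 0 < q by rewrite !sqrtr_gt0.
have q4 : q ^+ 4 = e by rewrite (exprM _ 2 2) !sqr_sqrtr ?sqrtr_ge0// ltW.
have q1 : q <= 1.
  by rewrite -(@ler_pXn2r _ 4)// ?nnegrE ?(ltW q0)// q4 expr1n ltW.
have qi : 0 < q^-1 by rewrite invr_gt0.
have -> : expR (7 / 4 * ln e^-1) = q^-1 ^+ 7.
  rewrite -q4 -exprVn lnXn// -[X in _ = X ^+ _](lnK (x := q^-1)) ?posrE//.
  by rewrite -expRM_natl; congr expR; rewrite -mulr_natl; field.
rewrite -[in covering_number _ _]q4; apply: holder_graph_covering => //.
by move=> x y; exact: hf.
Qed.

End FractalDimension.

(** * Bounding sampled increments by the number of covering balls *)

Section OscillationCount.
Context {R : realType}.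

(* The values [f a + 2 h i] lying between [f a] and [f b] are attained and
   need distinct balls. *)
Lemma oscillation_le_balls (f : R -> R) (a b h : R) n (T : {set 'I_n}) (v : 'I_n -> R) :
  continuous f -> a <= b -> 0 < h ->
  (forall y, a <= y <= b -> exists2 k, k \in T & `|f y - v k| < h) ->
  `|f b - f a| <= 2 * h * #|T|%:R.
Proof.
move=> cf ab h0 hT; rewrite leNgt; apply/negP => hlt.
pose lo := Num.min (f a) (f b); pose hi := Num.max (f a) (f b).
have hlo : hi - lo = `|f b - f a|.
  rewrite /hi /lo; have [h1|h1] := leP (f a) (f b).
    by rewrite ger0_norm// subr_ge0.
  by rewrite ltr0_norm ?subr_lt0// opprB.
(* If the bound failed, one more value than there are balls would fit between [f a] and [f b], with
   spacing 2 h, contradicting the pigeonhole principle. *)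
have ex (i : 'I_(#|T|.+1)) : exists k, k \in T /\ `|lo + 2 * h * i%:R - v k| < h.
  have [|y yab fy] := @IVT _ f a b (lo + 2 * h * i%:R) ab (continuous_subspaceT cf).
    rewrite -/lo -/hi lerDl mulr_ge0 ?mulr_ge0 ?(ltW h0)//=.
    rewrite -lerBrDl hlo (le_trans _ (ltW hlt))// ler_wpM2l ?mulr_ge0 ?(ltW h0)//.
    by rewrite ler_nat -ltnS.
  have [|k kT hk] := hT y; first by move: yab; rewrite in_itv.
  by exists k; rewrite -fy.
have [phi hphi] := choice ex.
have inj : injective phi.
  move=> i j e; have [_ hi1] := hphi i; have [_ hj1] := hphi j.
  rewrite e in hi1; apply/val_inj/eqP => /=; rewrite eqn_leq.
  move: hi1 hj1; rewrite !ltr_norml => /andP[a1 a2] /andP[a3 a4].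
  have i0 : 0 < 2 * h by rewrite mulr_gt0.
  apply/andP; split; rewrite leqNgt -(ltr_nat R); apply/negP => hij.
    have : (j.+1%:R <= i%:R :> R) by rewrite ler_nat -(ltr_nat R).
    by rewrite -natr1 -(ler_pM2l i0) mulrDr mulr1; lra.
  have : (i.+1%:R <= j%:R :> R) by rewrite ler_nat -(ltr_nat R).
  by rewrite -natr1 -(ler_pM2l i0) mulrDr mulr1; lra.
have : (#|codom phi| <= #|T|)%N.
  by apply: subset_leq_card; apply/fintype.subsetP => k /codomP[i ->]; have [] := hphi i.
by rewrite card_codom// card_ord ltnn.
Qed.

(** Applied to the columns met by one ball: its diameter is 2 h and the columns have width h, so at
    most three are met. *)
Lemma card_ord_window M (P : {set 'I_M}) :
  (forall i j, i \in P -> j \in P -> (j < i + 3)%N) -> (#|P| <= 3)%N.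
Proof.
move=> h; have [->|[i0 i0P]] := set_0Vmem P; first by rewrite cards0.
have := @arg_minnP _ i0 (mem P) (fun i : 'I_M => nat_of_ord i) i0P.
case=> m mP mmin.
pose phi (i : 'I_M) : 'I_3 := inord (i - m).
have hm i : i \in P -> (m <= i < m + 3)%N.
  by move=> iP; rewrite mmin// h.
rewrite -(card_in_imset (f := phi)); first by rewrite (leq_trans (max_card _))// card_ord.
move=> i j iP jP /(congr1 (@nat_of_ord _)).
have /andP[i1 i2] := hm _ iP; have /andP[j1 j2] := hm _ jP.
by rewrite !inordK; [move=> e; apply/val_inj => /=; lia|lia|lia].
Qed.

Lemma sum_columns (G : nat -> R) M L : (0 < L)%N ->
  \sum_(0 <= j < M * L) G (j %/ L)%N = L%:R * \sum_(0 <= i < M) G i.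
Proof.
move=> L0; elim: M => [|M IH]; first by rewrite mul0n !big_geq// mulr0.
rewrite [in RHS]big_nat_recr//= mulrDr -IH.
rewrite (big_cat_nat (n := M * L))//=; last by rewrite leq_mul2r leqnSn orbT.
congr (_ + _); rewrite mulSn -{1}[(M * L)%N]add0n big_addn addnK.
rewrite (eq_big_nat _ _ (F2 := fun=> G M)).
  by rewrite sumr_const_nat subn0 mulr_natl.
by move=> j /andP[_ jL]; rewrite addnC divnMDl// divn_small// addn0.
Qed.

Section Columns.
Variables (f : R -> R) (C : R).
Hypotheses (C_ge0 : 0 <= C) (f_per : periodic f (2 * pi)).
Hypothesis f_mod : forall x y q : R, 0 < q -> q <= 1 -> `|x - y| <= q ^+ 4 ->
    `|f x - f y| <= C * q.
Variables (M n : nat) (c : 'I_n -> R * R).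
Hypothesis M_gt0 : (0 < M)%N.
Let h : R := 2 * pi / M%:R.
Hypothesis f_cov : graph_on_torus f `<=` [set p | exists k, plane_ball (c k) h p].

Let h_gt0 : 0 < h.
Proof. by rewrite divr_gt0 ?mulr_gt0 ?pi_gt0// ltr0n. Qed.

Let h2_ge0 : 0 <= 2 * h.
Proof. by rewrite mulr_ge0// ltW. Qed.

Let hM : M%:R * h = 2 * pi.
Proof. by rewrite /h mulrC divfK// pnatr_eq0 -lt0n. Qed.

Let S (m : nat) : {set 'I_n} := [set k | `[< exists x, [/\ period_cell x,
  m%:R * h <= x < m.+1%:R * h & plane_ball (c k) h (x, f x)] >]].

Let plane_ball_fst (p : R * R) e x y : plane_ball p e (x, y) -> `|x - p.1| < e.
Proof.
rewrite /plane_ball/= => hp; apply: le_lt_trans hp.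
by rewrite -sqrtr_sqr ler_wsqrtr// lerDl sqr_ge0.
Qed.

Let plane_ball_snd (p : R * R) e x y : plane_ball p e (x, y) -> `|y - p.2| < e.
Proof.
rewrite /plane_ball/= => hp; apply: le_lt_trans hp.
by rewrite -sqrtr_sqr ler_wsqrtr// lerDr sqr_ge0.
Qed.

Let column_cover m x : (m < M)%N -> m%:R * h <= x < m.+1%:R * h ->
  exists2 k, k \in S m & `|f x - (c k).2| < h.
Proof.
move=> mM /andP[x1 x2].
have cx : period_cell x.
  rewrite /period_cell/= in_itv/=; apply/andP; split.
    by apply: le_trans x1; rewrite mulr_ge0// ltW.
  by rewrite (lt_le_trans x2)// -hM ler_pM2r// ler_nat.
have gx : graph_on_torus f (x, f x) by split.
have [k hk] := f_cov gx.
exists k; last exact: plane_ball_snd hk.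
by rewrite inE; apply/asboolP; exists x; rewrite x1 x2.
Qed.

(** The segment [x, x + h] stays within column [m] and its cyclic successor, so the balls of these
    two columns cover the graph over it. *)
Let step_le_balls m x : (m < M)%N -> m%:R * h <= x < m.+1%:R * h ->
  `|f (x + h) - f x| <= 2 * h * (#|S m|%:R + #|S (m.+1 %% M)|%:R).
Proof.
move=> mM /andP[x1 x2].
apply: (@le_trans _ _ (2 * h * #|S m :|: S (m.+1 %% M)|%:R)); last first.
  by rewrite (ler_wpM2l h2_ge0)// -natrD ler_nat cardsU leq_subr.
apply: (@oscillation_le_balls f _ _ h n _ (fun k => (c k).2)) => //.
- exact: quarter_modulus_continuous f_mod.
- by rewrite lerDl ltW.
move=> y /andP[y1 y2].
have [ym|ym] := ltP y (m.+1%:R * h).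
  have [|k kS hk] := @column_cover m y mM; first by rewrite (le_trans x1).
  by exists k => //; rewrite inE kS.
have e1 : m.+2%:R * h = m.+1%:R * h + h by rewrite -[m.+2%:R]natr1 mulrDl mul1r.
have [mM'|mM'] := ltnP m.+1 M.
  have [|k kS hk] := @column_cover m.+1 y mM'.
    by rewrite ym/= e1 (le_lt_trans y2)// ltrD2r.
  by exists k => //; rewrite inE modn_small// kS orbT.
have eM : m.+1 = M by apply/eqP; rewrite eqn_leq mM mM'.
(* After the last column the segment leaves the cell, and periodicity brings it back to column 0. *)
rewrite eM hM in ym x2.
have [|k kS hk] := @column_cover 0%N (y - 2 * pi) M_gt0.
  by rewrite mul0r mul1r subr_ge0 ym/= ltrBlDr (le_lt_trans y2)// addrC ltrD2l.
exists k; first by rewrite inE eM modnn kS orbT.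
by rewrite -(subrK (2 * pi) y) f_per.
Qed.

Let sum_column_balls : (\sum_(0 <= m < M) #|S m| <= 3 * n)%N.
Proof.
rewrite big_mkord.
have -> : (\sum_(m < M) #|S m| = \sum_(k < n) #|[set m : 'I_M | k \in S m]%SET|)%N.
  under eq_bigr do rewrite -sum1_card big_mkcond/=.
  rewrite exchange_big/=; apply: eq_bigr => k _.
  by rewrite -sum1_card [RHS]big_mkcond/=; apply: eq_bigr => m _; rewrite [in RHS]inE.
apply: (@leq_trans (\sum_(k < n) 3)%N); last by rewrite sum_nat_const card_ord mulnC.
apply: leq_sum => k _; apply: card_ord_window => i j; rewrite !inE.
move=> [x [_ /andP[x1 x2] /plane_ball_fst xk]].
move=> [y [_ /andP[y1 y2] /plane_ball_fst yk]].
rewrite -(ltr_nat R) natrD -(ltr_pM2r h_gt0) mulrDl.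
move: xk yk; rewrite !ltr_norml => /andP[a1 a2] /andP[a3 a4].
rewrite -natr1 mulrDl mul1r in x2; lra.
Qed.

(** In each square one factor is bounded by C q and the other by the ball count of two neighbouring
    columns. The constant is 12 = 2 * 2 * 3: the oscillation factor, two columns per increment,
    three columns per ball. *)
Lemma sampled_increments_le L (q : R) : (0 < L)%N -> 0 < q -> q <= 1 -> h <= q ^+ 4 ->
  \sum_(0 <= j < M * L)
    (f (2 * pi * j%:R / (M * L)%:R + h) - f (2 * pi * j%:R / (M * L)%:R)) ^+ 2 <=
  12 * L%:R * C * q * h * n%:R.
Proof.
move=> L0 q0 q1 hq.
pose G (m : nat) : R := C * q * (2 * h * (#|S m|%:R + #|S (m.+1 %% M)|%:R)).
have L0' : (0 : R) < L%:R by rewrite ltr0n.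
have M0' : (0 : R) < M%:R by rewrite ltr0n.
apply: (@le_trans _ _ (\sum_(0 <= j < M * L) G (j %/ L)%N)).
  apply: ler_sum_nat => j /andP[_ jK].
  set x := 2 * pi * j%:R / (M * L)%:R.
  have xE : x = j%:R / L%:R * h.
    by rewrite /x /h natrM; field; rewrite !gt_eqF.
  have mM : (j %/ L < M)%N by rewrite ltn_divLR.
  have hx : (j %/ L)%:R * h <= x < (j %/ L).+1%:R * h.
    rewrite xE ler_pM2r// ltr_pM2r// ler_pdivlMr// ltr_pdivrMr// -!natrM ler_nat ltr_nat.
    by rewrite leq_trunc_div/= -ltn_divLR.
  rewrite -real_normK ?num_real// expr2 /G ler_pM//; last exact: step_le_balls.
  by apply: f_mod => //; rewrite addrAC subrr add0r gtr0_norm.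
rewrite sum_columns// /G -mulr_sumr -mulr_sumr big_split/=.
have e : \sum_(0 <= m < M) (#|S (m.+1 %% M)|%:R : R) = \sum_(0 <= m < M) #|S m|%:R.
  case: M M_gt0 (S) => // M' _ S'.
  rewrite big_nat_recr//= modnn [in RHS]big_nat_recl//= addrC; congr (_ + _).
  by apply: eq_big_nat => i /andP[_ iM]; rewrite modn_small.
rewrite e -natr_sum; have := sum_column_balls; rewrite -(ler_nat R) natrM.
set s := (\sum_(0 <= i < M) _)%:R => hs.
have -> : L%:R * (C * q * (2 * h * (s + s))) = (4 * L%:R * C * q * h) * s by ring.
have -> : 12 * L%:R * C * q * h * n%:R = (4 * L%:R * C * q * h) * (3 * n%:R) by ring.
rewrite ler_wpM2l// (mulr_ge0 _ (ltW h_gt0))//.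
by rewrite !mulr_ge0// ltW.
Qed.

End Columns.

End OscillationCount.

(** * Energy of increments and the resulting lower bound on coverings *)

Section EnergyLowerBound.
Context {R : realType}.
Local Notation omega := (@gravity_dispersion R).

Lemma half_bounds (M N P0 : nat) : ((2 * P0).+2 <= M)%N -> (M <= N)%N ->
  [/\ (0 < M)%N, (M <= 4 * M./2)%N, (2 * M./2 <= M)%N, (P0 <= M./2)%N &
      (M./2 + N.+1 <= (2 * N).+1)%N].
Proof. by move=> *; split; lia. Qed.

(** Only the frequencies 1 <= n <= M / 2 are kept. There n h <= pi, so |e^(i n h) - 1| >= n h / 5
    cancels the 1 / n of the Fourier coefficient, and the jump energy of about M / 2 terms remains,
    multiplied by h^2. *)
Lemma increment_energy_lb (g : R -> R[i]) (t : R) :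
  step_function g -> non_constant g ->
  exists2 kappa : R, 0 < kappa & exists M0 : nat, forall M N K (h : R),
    (M0 <= M)%N -> (M <= N)%N -> (2 * N < K)%N -> h = 2 * pi / M%:R ->
    K%:R * kappa * h <= \sum_(0 <= l < K)
      nc (evolution_psum omega g t N (2 * pi * l%:R / K%:R + h) -
          evolution_psum omega g t N (2 * pi * l%:R / K%:R)) ^+ 2.
Proof.
move=> gs gnc; have [m [c [al [be [hab gE gF]]]]] := step_function_fourier gs.
have [p hp cp] := nonconstant_jump gnc hab gE.
pose b k : R[i] := (0 -i* (2 * pi)^-1) * c k.
have p0 := @pi_gt0 R; have p2 := @pi_ge2 R.
have bp : \sum_(k < m) b k * ((al k == p)%:R - (be k == p)%:R) != 0.
  rewrite /b; under eq_bigr do rewrite -mulrA; rewrite -mulr_sumr mulf_neq0//.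
  rewrite -nc_eq0 ncE/= expr0n/= add0r sqrtr_sqr normr_eq0 oppr_eq0 invr_eq0.
  by rewrite gt_eqF// mulr_gt0.
have [k0 k00 [P0 hP]] := jump_energy hab hp bp.
exists (k0 / 25); first by rewrite divr_gt0.
exists (2 * P0).+2 => M N K h hM MN NK hE.
have [M1 hPM PM PP0 PN] := half_bounds hM MN.
have M0 : (0 : R) < M%:R by rewrite ltr0n.
have h0 : 0 < h by rewrite hE divr_gt0// mulr_gt0.
have hMh : M%:R * h = 2 * pi by rewrite hE mulrC divfK// gt_eqF.
(* Multiplication by e^(i N x), of modulus one, shifts the frequencies from [-N, N] to [0, 2N], as
   discrete Parseval requires. *)
pose d (k : nat) : R[i] := fourier_coef g (k%:Z - N%:Z) *
  expi (t * omega (k%:Z - N%:Z)) * (expi ((k%:Z - N%:Z)%:~R * h) - 1).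
have dE x : nc (evolution_psum omega g t N (x + h) - evolution_psum omega g t N x) =
    nc (\sum_(0 <= k < (2 * N).+1) d k * expi (k%:R * x)).
  have -> : evolution_psum omega g t N (x + h) - evolution_psum omega g t N x =
      expi (- (N%:R * x)) * \sum_(0 <= k < (2 * N).+1) d k * expi (k%:R * x).
    rewrite /evolution_psum -sumrB big_mkord mulr_sumr; apply: eq_bigr => k _ /=.
    rewrite /d; set w := t * _; set n : int := _ - _.
    have -> : expi (w + n%:~R * (x + h)) = expi w * expi (n%:~R * x) * expi (n%:~R * h).
      by rewrite -!expiD; congr expi; ring.
    have -> : expi (w + n%:~R * x) = expi w * expi (n%:~R * x) by rewrite expiD.
    have -> : expi (n%:~R * x) = expi (- (N%:R * x)) * expi (k%:R * x).
      by rewrite -expiD; congr expi; rewrite /n intrB; ring.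
    by ring.
  by rewrite ncM nc_expi mul1r.
under eq_bigr do rewrite dE.
rewrite discrete_parseval// -mulrA ler_wpM2l//.
pose P := M./2.
pose A (n : nat) := \sum_(k < m) b k * (expi (- (n.+1%:R * al k)) - expi (- (n.+1%:R * be k))).
apply: (@le_trans _ _ (\sum_(0 <= i < P) (h / 5) ^+ 2 * nc (A i) ^+ 2)).
  rewrite -mulr_sumr; apply: (@le_trans _ _ ((h / 5) ^+ 2 * (k0 * P%:R))); last first.
    by rewrite ler_wpM2l ?sqr_ge0// hP.
  have -> : k0 / 25 * h = (h / 25 * k0) * 1 by ring.
  have -> : (h / 5) ^+ 2 * (k0 * P%:R) = (h / 25 * k0) * (P%:R * h) by field.
  rewrite ler_wpM2l//; first by rewrite mulr_ge0 ?divr_ge0// ltW.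
  (* Since 4 P h >= M h = 2 pi >= 4, one of the two factors h is absorbed by P h >= 1. *)
  have : (M%:R <= 4 * P%:R :> R) by rewrite -natrM ler_nat.
  move=> /(ler_wpM2r (ltW h0)); rewrite hMh; lra.
(* Index [i + N.+1] stands for the frequency [i + 1]; the blocks before and after these [P]
   frequencies are nonnegative and dropped. *)
have N2 : (N.+1 <= (2 * N).+1)%N by rewrite ltnS leq_pmull.
rewrite [leRHS](big_cat_nat (n := N.+1))//.
rewrite [X in _ <= _ + X](big_cat_nat (n := (P + N.+1)%N))//;
  last exact: leq_addl.
rewrite addrCA; apply: ler_wpDr.
  by apply: addr_ge0; apply: sumr_ge0 => i _; rewrite sqr_ge0.
rewrite -{1}[N.+1]add0n big_addn addnK; apply: ler_sum_nat => i /andP[_ iP].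
rewrite -exprMn ler_pXn2r ?nnegrE ?nc_ge0//; last first.
  by rewrite mulr_ge0 ?nc_ge0// divr_ge0// ltW.
rewrite /d; have -> : (i + N.+1)%N%:Z - N%:Z = i.+1%:Z by lia.
rewrite ncM ncM nc_expi mulr1 gF// -/(b _) ncM ncV.
have -> : (i.+1%:Z%:~R : R[i]) = i.+1%:R by [].
rewrite nc_nat -/(A i).
have -> : h / 5 * nc (A i) = nc (A i) / i.+1%:R * (i.+1%:R * h / 5).
  by field; rewrite addr_eq0; apply/eqP => e; have := ler0n R i; lra.
rewrite ler_wpM2l ?divr_ge0 ?nc_ge0//.
have i1 : 0 <= i.+1%:R * h by rewrite mulr_ge0// ltW.
have := @nc_expiB1_lb R (i.+1%:R * h); rewrite (ger0_norm i1); apply.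
have h3 : (i.+1%:R <= P%:R :> R) by rewrite ler_nat.
have : (2 * P%:R <= M%:R :> R) by rewrite -natrM ler_nat.
have := ler_wpM2r (ltW h0) h3.
move=> h4 /(ler_wpM2r (ltW h0)); rewrite hMh; lra.
Qed.

(* Comparing the increments of the solution, controlled by the coverings, with
   those of the partial sums, bounded below by Parseval. *)
Lemma covering_cardinals_lb (g u : R -> R[i]) (t C : R) :
  step_function g -> non_constant g -> 0 <= C -> quarter_holder u C ->
  periodic u (2 * pi) ->
  (forall x N, nc (evolution_psum omega g t N x - u x) <= C / root4 N.+1) ->
  exists2 kappa : R, 0 < kappa & exists M0 : nat, forall M (q h : R),
    (M0 <= M)%N -> h = 2 * pi / M%:R -> 0 < q -> q <= 1 -> h <= q ^+ 4 ->
    forall n1 (c1 : 'I_n1 -> R * R) n2 (c2 : 'I_n2 -> R * R),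
    graph_on_torus (fun x => complex.Re (u x)) `<=`
      [set p | exists k, plane_ball (c1 k) h p] ->
    graph_on_torus (fun x => complex.Im (u x)) `<=`
      [set p | exists k, plane_ball (c2 k) h p] ->
    kappa <= C * q * h * (n1%:R + n2%:R).
Proof.
move=> gs gnc C0 hu pu hN.
have [k0 k00 [M0 hM0]] := increment_energy_lb t gs gnc.
have p0 := @pi_gt0 R; have p2 := @pi_ge2 R.
exists (k0 / 6); first by rewrite divr_gt0.
exists M0.+1 => M q h hM hE q0 q1 hq n1 c1 n2 c2 cov1 cov2.
have M1 : (0 < M)%N by exact: leq_trans hM.
have M1' : (0 : R) < M%:R by rewrite ltr0n.
have h0 : 0 < h by rewrite hE divr_gt0// mulr_gt0.
have hMh : M%:R * h = 2 * pi by rewrite hE mulrC divfK// gt_eqF.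
set n : R := n1%:R + n2%:R.
(* Since M h = 2 pi >= 4, division by 24 gives the constant k0 / 6. *)
suff : M%:R * k0 * h <= 24 * C * q * h * n.
  move=> H; have : (M%:R * h) * k0 <= 24 * (C * q * h * n) by lra.
  by rewrite hMh => H2; have := ler_wpM2r (ltW k00) p2; lra.
(* The error comes from replacing the partial sum by [u] at both sample points: 2 (2 C / root4
   N.+1)^2, with one factor 1 / root4 bounded by 1. With [M] fixed it vanishes as [N] grows. *)
have key N : (M <= N)%N ->
    M%:R * k0 * h <= 24 * C * q * h * n + 8 * M%:R * C ^+ 2 * (root4 N.+1)^-1.
  move=> MN; pose L := (2 * N).+1; pose K := (M * L)%N.
  have L0 : (0 < L)%N by [].
  have L0' : (0 : R) < L%:R by rewrite ltr0n.
  have NK : (2 * N < K)%N by rewrite /K /L leq_pmull.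
  have H := hM0 M N K h (ltnW hM) MN NK hE.
  pose x l : R := 2 * pi * l%:R / K%:R.
  have r1 : (root4 N.+1)^-1 <= 1 :> R by rewrite invf_le1 ?root4_gt0// root4_ge1.
  have r0 := @root4V_ge0 R N.+1.
  have step l : nc (evolution_psum omega g t N (x l + h) - evolution_psum omega g t N (x l)) ^+ 2 <=
     2 * ((complex.Re (u (x l + h)) - complex.Re (u (x l))) ^+ 2 +
          (complex.Im (u (x l + h)) - complex.Im (u (x l))) ^+ 2) +
     8 * C ^+ 2 * (root4 N.+1)^-1.
    set v1 := evolution_psum _ _ _ _ _; set v2 := evolution_psum _ _ _ _ _.
    have -> : v1 - v2 = (u (x l + h) - u (x l)) + ((v1 - u (x l + h)) - (v2 - u (x l))) by ring.
    apply: (le_trans (sqr_ncD_le _ _)); rewrite (sqr_nc (u (x l + h) - _)) ReB ImB.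
    rewrite lerD2l.
    set w := v1 - _ - _.
    have hw : nc w <= 2 * (C / root4 N.+1).
      by rewrite (le_trans (ncB _ _))// mulr2n mulrDl mul1r lerD// hN.
    have : nc w ^+ 2 <= (2 * (C / root4 N.+1)) ^+ 2.
      rewrite ler_pXn2r ?nnegrE ?nc_ge0//; exact: le_trans (nc_ge0 _) hw.
    have : C ^+ 2 * ((root4 N.+1)^-1 * (root4 N.+1)^-1) <= C ^+ 2 * (root4 N.+1)^-1.
      by rewrite ler_wpM2l ?sqr_ge0// ler_piMr.
    have -> : (2 * (C / root4 N.+1)) ^+ 2 = 4 * (C ^+ 2 * ((root4 N.+1)^-1 * (root4 N.+1)^-1)).
      by ring.
    lra.
  have Hs := le_trans H (ler_sum_nat (fun l _ => step l)).
  rewrite big_split/= -mulr_sumr big_split/= sumr_const_nat subn0 -[_ *+ K]mulr_natr in Hs.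
  have fm1 (a e r : R) : 0 < r -> r <= 1 -> `|a - e| <= r ^+ 4 ->
      `|complex.Re (u a) - complex.Re (u e)| <= C * r.
    by move=> ? ? ?; rewrite -ReB (le_trans (normr_Re_le _))// hu.
  have fm2 (a e r : R) : 0 < r -> r <= 1 -> `|a - e| <= r ^+ 4 ->
      `|complex.Im (u a) - complex.Im (u e)| <= C * r.
    by move=> ? ? ?; rewrite -ImB (le_trans (normr_Im_le _))// hu.
  have cov1' := cov1; have cov2' := cov2; have hq' := hq; rewrite hE in cov1' cov2' hq'.
  have s1 := @sampled_increments_le R (fun x => complex.Re (u x)) C C0 _
    fm1 M n1 c1 M1 cov1' L q L0 q0 q1 hq'.
  have s2 := @sampled_increments_le R (fun x => complex.Im (u x)) C C0 _
    fm2 M n2 c2 M1 cov2' L q L0 q0 q1 hq'.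
  have {}s1 := s1 (fun x => congr1 _ (pu x)).
  have {}s2 := s2 (fun x => congr1 _ (pu x)).
  rewrite -hE -/K in s1 s2.
  rewrite -(ler_pM2l L0').
  have -> : L%:R * (M%:R * k0 * h) = K%:R * k0 * h by rewrite /K natrM; ring.
  have -> : L%:R * (24 * C * q * h * n + 8 * M%:R * C ^+ 2 / root4 N.+1) =
    2 * (12 * L%:R * C * q * h * n1%:R + 12 * L%:R * C * q * h * n2%:R) +
    8 * C ^+ 2 / root4 N.+1 * K%:R.
    by rewrite /K natrM /n; ring.
  rewrite /x in Hs; lra.
apply/ler_addgt0Pr => e e0.
pose Y : R := 8 * M%:R * C ^+ 2 + 1.
have Y0 : 0 < Y by rewrite ltr_wpDl// !mulr_ge0// ?sqr_ge0// ltW.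
have /cvgrPdist_lt /(_ (e / Y)) := @root4_cvg0 R.
case=> [|N1 _ hN1]; first by rewrite divr_gt0.
have := hN1 (maxn M N1).+1 (leqW (leq_maxr _ _)).
rewrite sub0r normrN ger0_norm ?root4V_ge0// ltr_pdivlMr// => hY.
have := key (maxn M N1) (leq_maxl _ _).
have r0 := @root4V_ge0 R (maxn M N1).+1.
rewrite /Y in hY; lra.
Qed.

End EnergyLowerBound.

(** The existence clause guarantees that [evolution_dimension] concerns a genuine representative and
    not the default value of [xget]. *)
Theorem mainTheorem17 (R : realType) (g : R -> R[i])
    (g_step : step_function g) (g_nonconst : non_constant g)
    (t : R) (t_neq0 : t != 0) :
  (exists u : R -> R[i],
     continuous_representative (@gravity_dispersion R) g t u) /\
  ((5 / 4)%:E <= evolution_dimension (@gravity_dispersion R) g t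
              <= (7 / 4)%:E)%E.
Proof.
have [u [C [C0 hu hN hrep]]] := evolution_limit g_step t_neq0.
have urep : continuous_representative (@gravity_dispersion R) g t u by apply/hrep.
split; first by exists u.
rewrite /evolution_dimension.
have -> : xget (fun=> 0) [set u | continuous_representative (@gravity_dispersion R) g t u] = u.
  by apply/hrep; apply: (xgetPex (fun=> 0)); exists u.
have [pu _ _ _] := urep.
apply/andP; split; last first.
  rewrite ge_max; apply/andP; split; apply: (holder_graph_dimension C0) => x y q q0 q1 xy.
    by rewrite -ReB (le_trans (normr_Re_le _))// hu.
  by rewrite -ImB (le_trans (normr_Im_le _))// hu.
rewrite leNgt gt_max; apply/negP => /andP[].
move=> /fractal_dimension_lt[r1 r1s [d1 d10 hd1]].
move=> /fractal_dimension_lt[r2 r2s [d2 d20 hd2]].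
have [k k0 [M0 hM]] := covering_cardinals_lb g_step g_nonconst C0 hu pu hN.
have p0 := @pi_gt0 R.
(* A nonnegative exponent gives h^(-s) >= 1, which absorbs the unit lost when passing from the
   covering number to an actual cover. *)
pose s : R := Num.max 0 (Num.max r1 r2).
have s0 : 0 <= s by rewrite le_max lexx.
have rs1 : r1 <= s by rewrite !le_max lexx orbT.
have rs2 : r2 <= s by rewrite !le_max lexx !orbT.
have s54 : s < 5 / 4 by rewrite !gt_max r1s r2s !andbT; lra.
pose tau : R := 5 / 4 - s; have tau0 : 0 < tau by rewrite subr_gt0.
(* Chosen so that l > [l0] gives k tau l > 4 C, the inequality that closes the contradiction. *)
pose l0 : R := 4 * C / (k * tau).
pose d : R := Num.min (Num.min d1 d2) (Num.min 1 (expR (- l0))).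
have d0 : 0 < d by rewrite !lt_min d10 d20 ltr01 expR_gt0.
pose M := (M0 + (Num.truncn (2 * pi / d)).+1)%N.
have MM : (M0 <= M)%N by exact: leq_addr.
have M1 : (0 : R) < M%:R by rewrite ltr0n /M addnS.
pose h : R := 2 * pi / M%:R.
have h0 : 0 < h by rewrite divr_gt0// mulr_gt0.
have hd : h < d.
  rewrite /h ltr_pdivrMr// -ltr_pdivrMl// mulrC (lt_le_trans (truncnS_gt _))//.
  by rewrite ler_nat leq_addl.
move: (hd); rewrite !lt_min => /andP[/andP[hd1' hd2'] /andP[h1 hl]].
pose l : R := ln h^-1.
have hi : 1 < h^-1 by rewrite invf_gt1.
have lpos : 0 < l by rewrite ln_gt0.
have hexp : h = expR (- l) by rewrite /l lnV ?posrE// opprK lnK.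
have ll : l0 < l by move: hl; rewrite hexp ltr_expR ltrN2.
pose q : R := expR (- (l / 4)).
have q0 : 0 < q by exact: expR_gt0.
have q1 : q <= 1 by rewrite -expR0 ler_expR; lra.
have q4 : q ^+ 4 = h.
  by rewrite hexp -expRM_natl; congr expR; rewrite -mulr_natr; lra.
have [n1 [c1 [cov1 hn1]]] := covering_number_exists (hd1 _ h0 hd1').
have [n2 [c2 [cov2 hn2]]] := covering_number_exists (hd2 _ h0 hd2').
have hq : h <= q ^+ 4 by rewrite q4.
have := hM M q h MM erefl q0 q1 hq _ _ _ _ cov1 cov2.
(* With q = h^(1/4) and at most 4 h^(-s) balls, the right-hand side is at most 4 C h^(5/4 - s) = 4 C
   e^(-tau l), which is less than k because e^(tau l) >= 1 + tau l. *)
apply/negP; rewrite -ltNge.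
have ebound r : r <= s -> expR (r * ln h^-1) + 1 <= 2 * expR (s * l).
  move=> rs; have : expR (r * l) <= expR (s * l) by rewrite ler_expR ler_pM2r.
  have : 1 <= expR (s * l) by rewrite -expR0 ler_expR mulr_ge0// ltW.
  by rewrite /l; lra.
have nb : n1%:R + n2%:R <= 4 * expR (s * l).
  by have := ebound _ rs1; have := ebound _ rs2; lra.
have qh0 : 0 <= C * q * h by rewrite !mulr_ge0// ltW.
apply: (le_lt_trans (ler_wpM2l qh0 nb)).
have -> : C * q * h * (4 * expR (s * l)) = 4 * C * expR (- (tau * l)).
  have -> : - (tau * l) = - (l / 4) + (- l) + s * l by rewrite /tau; field.
  by rewrite !expRD -hexp -/q; ring.
rewrite expRN ltr_pdivrMr ?expR_gt0//.
have et := expR_ge1Dx (tau * l).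
have kt : 0 < k * tau by rewrite mulr_gt0.
have : 4 * C < k * tau * l by rewrite -ltr_pdivrMl// mulrC.
have := ler_wpM2l (ltW k0) et; lra.
Qed.
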